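(* Let $(W,S)$ be a Coxeter system with $W$ infinite. The poset $\overline{W}$ (the elements of $W$ together with the infinite reduced words, under the weak order) is a complete lattice if and only if $W$ is isomorphic to the weak direct product of a countable (finite or countably infinite) family $(W_i)_i$ of Coxeter groups, where each $W_i$ is either a finite or a locally finite irreducible Coxeter group.
   Context: $S$ is allowed to be infinite. $\Phi$ is the root system of $(W,S)$ (in the standard reflection representation), $\Phi^+$ and $\Phi^-=-\Phi^+$ the sets of positive and negative roots. For $w\in W$ put $\Phi_w=\{\alpha\in\Phi^+ : w^{-1}(\alpha)\in\Phi^-\}$. An infinite reduced expression is a sequence $s_1s_2s_3\cdots$ with $s_i\in S$ such that $s_1s_2\cdots s_k$ is a reduced expression for every $k\ge 1$; put $\Phi_{s_1s_2s_3\cdots}=\bigcup_{i\ge1}\Phi_{s_1s_2\cdots s_i}$. Two infinite reduced expressions are equivalent if the associated sets $\Phi_{s_1s_2\cdots}$ are equal. $W_l$ is the set of equivalence classes (infinite reduced words), $\Phi_w$ for $w\in W_l$ is the common set attached to the class, and $\overline{W}=W_l\uplus W$ (disjoint union). The weak order on $\overline{W}$ is: $x\le y$ if and only if $\Phi_x\subset\Phi_y$. A locally finite Coxeter system is a Coxeter system $(W,S)$ such that $W$ is infinite and the standard parabolic subgroup $W_J$ is finite for every finite $J\subset S$. The weak direct product of groups is the subgroup of the direct product consisting of the elements with only finitely many non-identity components. *)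

(* Defs.v *)
From Stdlib Require Import Relation_Operators.
From mathcomp Require Import all_boot all_order all_algebra.
From mathcomp Require Import finmap generic_quotient.
From mathcomp Require Import boolp classical_sets functions cardinality.
From mathcomp Require Import reals trigo.
From mathcomp Require Import monalg.

Set Implicit Arguments.
Unset Strict Implicit.
Unset Printing Implicit Defensive.

Import Order.TTheory GRing.Theory Num.Theory.

Local Open Scope classical_set_scope.
Local Open Scope quotient_scope.
Local Open Scope ring_scope.

Section Groups.
Variable W : groupType.
Local Open Scope group_scope.

Definition subgroup (H : set W) : Prop :=
  H 1 /\ forall x y, H x -> H y -> H (x * y^-1).

Definition generated (A : set W) : set W := smallest subgroup A.

End Groups.

(* The value 0 encodes m(i, j) = oo. *)
Definition coxeter_matrix (I : Type) (m : I -> I -> nat) : Prop :=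
  [/\ forall i, m i i = 1%N,
      forall i j, m i j = m j i
    & forall i j, i <> j -> m i j <> 1%N].

(* Deletion of one relator (i j)^m(i, j) in a word.  For m(i, j) = oo the
   relator is the empty word. *)
Inductive coxeter_step (I : Type) (m : I -> I -> nat) :
    seq I -> seq I -> Prop :=
| CoxeterStep u v i j :
    coxeter_step m (u ++ flatten (nseq (m i j) [:: i; j]) ++ v) (u ++ v).

Definition word_prod (W : groupType) (I : Type) (s : I -> W) (u : seq I) : W :=
  (\prod_(i <- u) s i)%g.

(* W = < S | (s t)^m(s, t) = 1 >.  As m(i, i) = 1, the words i i are relators,
   so the monoid presented by these relators is already the presented group
   and words with inverse letters are not needed. *)
Definition coxeter_system (W : groupType) (I : Type) (m : I -> I -> nat)
    (s : I -> W) : Prop :=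
  [/\ coxeter_matrix m,
      forall w, exists u, word_prod s u = w
    & forall u v, word_prod s u = word_prod s v <->
        clos_refl_sym_trans _ (coxeter_step m) u v].

Section RootSystem.
Variables (R : realType) (W : groupType) (I : choiceType).
Variables (m : I -> I -> nat) (s : I -> W).

(* Real vector space with basis the simple roots: finitely supported functions
   I -> R. *)
Local Notation V := {malg R[I]}.

Definition simple_root (i : I) : V := mkmalgU i 1.

Definition cos_matrix (i j : I) : R :=
  if m i j == 0%N then -1 else - cos (pi / (m i j)%:R).

Definition bilin_form (u v : V) : R :=
  \sum_(i <- msupp u) \sum_(j <- msupp v)
    mcoeff i u * mcoeff j v * cos_matrix i j.

Definition reflection (i : I) (v : V) : V :=
  v - (2 * bilin_form (simple_root i) v) *: simple_root i.

(* The action of w is read off an expression of w, chosen once and for all;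
   for a Coxeter system it does not depend on the choice, since the
   reflections satisfy the defining relations. *)
Definition expression (w : W) : seq I := xget [::] [set u | word_prod s u = w].

Definition act (w : W) (v : V) : V := foldr reflection v (expression w).

Definition roots : set V :=
  [set a | exists w i, a = act w (simple_root i)].

Definition pos_roots : set V :=
  [set a | roots a /\ forall i, 0 <= mcoeff i a].

Definition neg_roots : set V := [set - a | a in pos_roots].

Definition inversions (w : W) : set V :=
  [set a | pos_roots a /\ neg_roots (act w^-1%g a)].

Definition reduced (u : seq I) : Prop :=
  forall v, word_prod s v = word_prod s u -> (size u <= size v)%N.

Definition inf_reduced (e : nat -> I) : Prop :=
  forall k, (0 < k)%N -> reduced (mkseq e k).

Definition inf_inversions (e : nat -> I) : set V :=
  \bigcup_(k in [set k | (0 < k)%N]) inversions (word_prod s (mkseq e k)).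

Local Notation inf_expr := {e : nat -> I | `[< inf_reduced e >]}.

Definition inf_equiv (e f : inf_expr) : bool :=
  `[< inf_inversions (val e) = inf_inversions (val f) >].

Lemma inf_equiv_is_equiv : equiv_class_of inf_equiv.
Proof.
split=> [e|e f|f e g]; first exact/asboolP.
  by apply/asboolP/asboolP => ->.
by move=> /asboolP ef /asboolP fg; apply/asboolP; rewrite ef.
Qed.

Canonical inf_equiv_rel := EquivRelPack inf_equiv_is_equiv.

Definition inf_word : Type := {eq_quot inf_equiv}.

Definition Wbar : Type := (inf_word + W)%type.

Definition Wbar_inversions (x : Wbar) : set V :=
  match x with
  | inl c => inf_inversions (val (repr (c : {eq_quot inf_equiv})))
  | inr w => inversions w
  end.

Definition weak_le (x y : Wbar) : Prop :=
  Wbar_inversions x `<=` Wbar_inversions y.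

End RootSystem.
Arguments weak_le R {W I} m s x y.

Section CompleteLattice.
Variables (T : Type) (le : T -> T -> Prop).

Definition is_lub (A : set T) (x : T) : Prop :=
  (forall a, A a -> le a x) /\ (forall y, (forall a, A a -> le a y) -> le x y).

Definition is_glb (A : set T) (x : T) : Prop :=
  (forall a, A a -> le x a) /\ (forall y, (forall a, A a -> le y a) -> le y x).

Definition complete_lattice : Prop :=
  [/\ forall x, le x x,
      forall x y z, le x y -> le y z -> le x z,
      forall x y, le x y -> le y x -> x = y
    & forall A : set T, (exists x, is_lub A x) /\ (exists x, is_glb A x)].

End CompleteLattice.

Definition parabolic (W : groupType) (I : Type) (s : I -> W) (J : set I) :
  set W := generated (s @` J).

Definition locally_finite (W : groupType) (I : Type) (s : I -> W) : Prop :=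
  infinite_set [set: W] /\
  forall J : set I, finite_set J -> finite_set (parabolic s J).

Definition coxeter_edge (I : Type) (m : I -> I -> nat) (i j : I) : Prop :=
  m i j = 0%N \/ (2 < m i j)%N.

Definition irreducible (I : Type) (m : I -> I -> nat) : Prop :=
  inhabited I /\ forall i j, clos_refl_trans I (coxeter_edge m) i j.

Definition finite_coxeter_group (W : groupType) : Prop :=
  finite_set [set: W] /\
  exists (I : choiceType) (m : I -> I -> nat) (s : I -> W),
    coxeter_system m s.

Definition locally_finite_irreducible_coxeter_group (W : groupType) : Prop :=
  exists (I : choiceType) (m : I -> I -> nat) (s : I -> W),
    [/\ coxeter_system m s, locally_finite s & irreducible m].

Definition weak_dprod (K : Type) (G : K -> groupType) :
  set (forall k, G k) := [set g | finite_set [set k | g k <> 1%g]].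
Arguments weak_dprod {K} G.

Definition isog_weak_dprod (W : groupType) (K : Type) (G : K -> groupType) :
    Prop :=
  exists f : W -> forall k, G k,
    (forall x y k, f (x * y)%g k = (f x k * f y k)%g) /\
    set_bij [set: W] (weak_dprod G) f.

(* Main.v *)
(* Tits' theorem (w alpha_i is a nonnegative combination of simple roots as soon
   as w s_i is longer than w) identifies the inclusion of inversion sets with
   the prefix order on W.  If the completed weak order has a greatest element,
   this element is an infinite word, as W is infinite.  Its inversion set is a
   countable increasing union of finite sets and contains all simple roots; a
   prefix which inverts the simple roots of a finite J bounds W_J, so that W_J
   is finite, and S is countable.  Conversely, if all W_J with J finite are
   finite, then two elements of W have an upper bound, namely the longest
   element of some W_J, and hence a join; if moreover S is countable, then so is
   W, and the union of the inversion sets along an increasing sequence of finite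
   joins is the least upper bound of a family of elements or infinite words.

   Countable, locally finite Coxeter systems are then related to weak direct
   products by splitting W along the connected components of the Coxeter graph.
   In the other direction, local finiteness and countability do not depend on
   the generators, and a locally finite irreducible system is countable because
   a vertex of its graph has at most three neighbours. *)

From HB Require Import structures.
From Stdlib Require Import Relation_Operators Operators_Properties.
Require Import Defs.
From mathcomp Require Import all_boot all_order all_algebra.
From mathcomp Require Import finmap generic_quotient ring lra zify.
From mathcomp Require Import boolp classical_sets functions cardinality.
From mathcomp Require Import reals trigo monalg.

Set Implicit Arguments.
Unset Strict Implicit.
Unset Printing Implicit Defensive.

Import Order.TTheory GRing.Theory Num.Theory.

Local Open Scope classical_set_scope.
Local Open Scope ring_scope.

(** * The reflection representation *)

Section ChebyshevU.
Variable R : realType.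
Implicit Types (c phi : R) (k : nat).

(** These are the Chebyshev polynomials of the second kind with shifted index, U_(k-1)(c). The
    recursion also covers c = 1, the case m(i, j) = oo, where the quotient sin(k phi) / sin(phi) has
    no meaning. *)
Fixpoint chebyshevU c k : R :=
  match k with
  | 0 => 0
  | 1 => 1
  | (k'.+1 as k1).+1 => 2 * c * chebyshevU c k1 - chebyshevU c k'
  end.

Lemma chebyshevUSS c k :
  chebyshevU c k.+2 = 2 * c * chebyshevU c k.+1 - chebyshevU c k.
Proof. by []. Qed.

Lemma chebyshevU1 k : chebyshevU 1 k = k%:R.
Proof.
elim/ltn_ind: k => -[|[|k]] // IH.
rewrite chebyshevUSS !IH // -[k.+2%:R]natr1 -[k.+1%:R]natr1; ring.
Qed.

Lemma chebyshevU_cos phi k :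
  chebyshevU (cos phi) k * sin phi = sin (k%:R * phi).
Proof.
elim/ltn_ind: k => -[|[|k]] IH; first by rewrite !mul0r sin0.
  by rewrite !mul1r.
rewrite chebyshevUSS mulrBl -[_ * _ * sin phi]mulrA !IH //.
have -> : k.+2%:R * phi = k.+1%:R * phi + phi :> R.
  by rewrite -[k.+2%:R]natr1; ring.
have -> : k%:R * phi = k.+1%:R * phi - phi :> R by rewrite -[k.+1%:R]natr1; ring.
rewrite sinB sinD. ring.
Qed.

End ChebyshevU.

(** * The bilinear form and the dihedral relations between reflections *)

Section BilinearForm.
Variables (R : realType) (I : choiceType) (m : I -> I -> nat).
Hypothesis cox : coxeter_matrix m.
Local Notation V := {malg R[I]}.
Local Notation B := (@bilin_form R I m).
Local Notation alpha := (@simple_root R I).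
Implicit Types (u v w : V) (i j h : I) (c : R) (n k : nat).

Lemma mcoeff_simple_root i j : mcoeff j (alpha i) = (i == j)%:R.
Proof. by rewrite mcoeffU. Qed.

Lemma simple_root_inj : injective alpha.
Proof.
move=> i j /(congr1 (mcoeff j)); rewrite !mcoeff_simple_root eqxx.
by case: eqP => // _ /eqP; rewrite eq_sym oner_eq0.
Qed.

Lemma cos_matrixC i j : cos_matrix R m i j = cos_matrix R m j i.
Proof. by case: cox => _ mC _; rewrite /cos_matrix mC. Qed.

Lemma cos_matrix_diag i : cos_matrix R m i i = 1.
Proof.
by case: cox => mii _ _; rewrite /cos_matrix mii /= divr1 cospi opprK.
Qed.

Lemma coxeter_matrix_ge2 i j : i != j -> m i j != 0%N -> (1 < m i j)%N.
Proof.
by case: cox => _ _ mij /eqP/mij; case: (m i j) => [|[|n]].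
Qed.

Lemma cos_matrix_le0 i j : i != j -> cos_matrix R m i j <= 0.
Proof.
move=> ij; rewrite /cos_matrix; case: eqVneq => [_|mn0]; first lra.
rewrite oppr_le0; apply: cos_ge0_pihalf.
have m2 := coxeter_matrix_ge2 ij mn0.
have pi0 := pi_gt0 R.
have mr0 : 0 < (m i j)%:R :> R by rewrite ltr0n lt0n.
apply/andP; split.
  apply: (@le_trans _ _ 0); first by rewrite oppr_le0 divr_ge0 // ltW.
  by rewrite divr_ge0 // ltW.
by rewrite ler_pM2l // lef_pV2 ?posrE // ler_nat.
Qed.

(** The sums in [bilin_form] run over supports, which change under addition; as an iterated [mmap]
    the form inherits linearity. *)
Lemma bilin_mmap u v :
  B u v = mmap idfun (fun i => mmap idfun (cos_matrix R m i) v) u.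
Proof.
rewrite /bilin_form mmapE; apply: eq_bigr => i _.
rewrite mmapE mulr_sumr; apply: eq_bigr => j _ /=.
by rewrite mulrA.
Qed.

Lemma mmapZ_idfun (h : I -> R) c v : mmap idfun h (c *: v) = c * mmap idfun h v.
Proof.
rewrite (mmapEw (msuppZ_le _ _)) mmapE big_distrr /=.
by apply/eq_bigr=> k _; rewrite mcoeffZ mulrA.
Qed.

Lemma bilinC u v : B u v = B v u.
Proof.
rewrite /bilin_form exchange_big; apply: eq_bigr => i _; apply: eq_bigr => j _.
by rewrite (cos_matrixC i); ring.
Qed.

Lemma bilinDl u v w : B (u + v) w = B u w + B v w.
Proof. by rewrite !bilin_mmap mmapD. Qed.

Lemma bilinZl c u w : B (c *: u) w = c * B u w.
Proof. by rewrite !bilin_mmap mmapZ_idfun. Qed.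

Lemma bilinDr u v w : B w (u + v) = B w u + B w v.
Proof. by rewrite bilinC bilinDl !(bilinC w). Qed.

Lemma bilinZr c u w : B w (c *: u) = c * B w u.
Proof. by rewrite bilinC bilinZl !(bilinC w). Qed.

Lemma bilinNr u w : B w (- u) = - B w u.
Proof. by rewrite -scaleN1r bilinZr mulN1r. Qed.

Lemma bilinBr u v w : B w (u - v) = B w u - B w v.
Proof. by rewrite bilinDr bilinNr. Qed.

Lemma bilinNl u w : B (- w) u = - B w u.
Proof. by rewrite -scaleN1r bilinZl mulN1r. Qed.

Lemma bilinBl u v w : B (u - v) w = B u w - B v w.
Proof. by rewrite bilinDl bilinNl. Qed.

Lemma bilin_simple i j : B (alpha i) (alpha j) = cos_matrix R m i j.
Proof. by rewrite bilin_mmap !mmapU /= !mul1r. Qed.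

Lemma bilin_simple_diag i : B (alpha i) (alpha i) = 1.
Proof. by rewrite bilin_simple cos_matrix_diag. Qed.

Local Notation refl := (@reflection R I m).

Lemma reflectionD i u v : refl i (u + v) = refl i u + refl i v.
Proof. by rewrite /reflection bilinDr mulrDr scalerDl opprD addrACA. Qed.

Lemma reflectionZ i c v : refl i (c *: v) = c *: refl i v.
Proof. by rewrite /reflection bilinZr scalerBr scalerA mulrCA. Qed.

Lemma reflectionN i v : refl i (- v) = - refl i v.
Proof. by rewrite -scaleN1r reflectionZ scaleN1r. Qed.

Lemma reflection_simple i : refl i (alpha i) = - alpha i.
Proof.
rewrite /reflection bilin_simple_diag.
by apply/malgP => h; rewrite mcoeffB mcoeffZ mcoeffN; ring.
Qed.

Lemma reflectionK i : involutive (refl i).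
Proof.
move=> v; rewrite {1}/reflection bilinBr bilinZr bilin_simple_diag.
by apply/malgP => h; rewrite /reflection !(mcoeffB, mcoeffZ); ring.
Qed.

Lemma bilin_reflection i u v : B (refl i u) (refl i v) = B u v.
Proof.
rewrite /reflection !(bilinBl, bilinBr, bilinZl, bilinZr) bilin_simple_diag.
rewrite (bilinC u (alpha i)); ring.
Qed.

Lemma mcoeff_reflection i j v :
  mcoeff j (refl i v) = mcoeff j v - (2 * B (alpha i) v) *+ (i == j).
Proof. by rewrite mcoeffB mcoeffZ mcoeff_simple_root mulr_natr. Qed.

Lemma mcoeff_reflection_neq i j v : i != j -> mcoeff j (refl i v) = mcoeff j v.
Proof. by move=> /negPf ij; rewrite mcoeff_reflection ij subr0. Qed.

(* Images of alpha_i under alternating products of r_i and r_j: for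
   c = cos phi, chebyshevU c n = sin (n phi) / sin phi. *)
Definition dihedral_root i j n : V :=
  chebyshevU (- cos_matrix R m i j) n.+1 *: alpha i
    + chebyshevU (- cos_matrix R m i j) n *: alpha j.

Lemma dihedral_root0 i j : dihedral_root i j 0 = alpha i.
Proof. by rewrite /dihedral_root scale1r scale0r addr0. Qed.

(** With c = - [cos_matrix], r_j keeps the coefficient of alpha_i and turns that of alpha_j into 2 c
    U(n + 1) - U(n), which is the recursion of [chebyshevU]. *)
Lemma reflection_dihedral_root i j n :
  refl j (dihedral_root i j n) = dihedral_root j i n.+1.
Proof.
rewrite {1}/dihedral_root reflectionD !reflectionZ reflection_simple.
rewrite /reflection bilin_simple /dihedral_root chebyshevUSS (cos_matrixC j).
by apply/malgP => h; rewrite !(mcoeffD, mcoeffZ, mcoeffB, mcoeffN); ring.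
Qed.

Lemma dihedral_rootE i j n : dihedral_root i j n =
  chebyshevU (- cos_matrix R m i j) n.+1 *: alpha i
    + chebyshevU (- cos_matrix R m i j) n *: alpha j.
Proof. by []. Qed.

Local Opaque dihedral_root.

Lemma iter_dihedral_root i j n k :
  iter k (refl i \o refl j) (dihedral_root i j n) = dihedral_root i j (k.*2 + n).
Proof.
elim: k => [//|k IH]; rewrite iterS IH /= !reflection_dihedral_root.
by rewrite doubleS !addSn.
Qed.

Lemma iter_dihedral_rootV i j n k :
  iter k (refl i \o refl j) (refl j (dihedral_root j i n)) =
  refl j (dihedral_root j i (k.*2 + n)).
Proof.
elim: k => [//|k IH]; rewrite iterS IH /= reflectionK reflection_dihedral_root.
by rewrite doubleS !addSn -(reflection_dihedral_root i j) reflectionK.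
Qed.

Lemma sin_piV_gt0 n : (1 < n)%N -> 0 < sin (pi / n%:R) :> R.
Proof.
move=> n1; apply: sin_gt0_pi; have pi0 := pi_gt0 R.
have n0 : 0 < n%:R :> R by rewrite ltr0n (ltn_trans _ n1).
by rewrite divr_gt0 // ltr_pdivrMr // ltr_pMr // ltr1n.
Qed.

(** For finite m the value is sin(k pi / m) / sin(pi / m), and the angle k pi / m stays in [0, pi];
    for m = oo the value is k. *)
Lemma chebyshevU_ge0 i j k : i != j -> (m i j = 0 \/ k <= m i j)%N ->
  0 <= chebyshevU (- cos_matrix R m i j) k.
Proof.
move=> ij; rewrite /cos_matrix; case: eqVneq => [_ _|mn0 [/eqP|km]].
- by rewrite opprK chebyshevU1.
- by rewrite (negPf mn0).
rewrite opprK; have := sin_piV_gt0 (coxeter_matrix_ge2 ij mn0) => sin0.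
rewrite -(pmulr_lge0 _ sin0) chebyshevU_cos.
have mr0 : 0 < (m i j)%:R :> R by rewrite ltr0n lt0n.
apply: sin_ge0_pi; have pi0 := pi_gt0 R.
rewrite !mulr_ge0 ?invr_ge0 ?(ltW pi0) //= mulrA ler_pdivrMr // mulrC.
by rewrite ler_pM2l // ler_nat.
Qed.

(** Raising the index by 2m adds 2 pi to the angle. *)
Lemma dihedral_root_period i j n : i != j -> m i j != 0%N ->
  dihedral_root i j ((m i j).*2 + n) = dihedral_root i j n.
Proof.
move=> ij mn0; rewrite !dihedral_rootE -addnS.
have per k : chebyshevU (- cos_matrix R m i j) ((m i j).*2 + k) =
             chebyshevU (- cos_matrix R m i j) k.
  rewrite /cos_matrix (negPf mn0) opprK.
  have := sin_piV_gt0 (coxeter_matrix_ge2 ij mn0) => /lt0r_neq0 sn0.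
  apply: (mulIf sn0); rewrite !chebyshevU_cos natrD mulrDl.
  have -> : (m i j).*2%:R * (pi / (m i j)%:R) = pi *+ 2 :> R.
    rewrite -muln2 natrM mulr2n; field.
    by rewrite pnatr_eq0.
  by rewrite addrC sinD2pi.
by rewrite !per.
Qed.

Lemma iter_reflection_fix i j k v : B (alpha i) v = 0 -> B (alpha j) v = 0 ->
  iter k (refl i \o refl j) v = v.
Proof.
move=> vi vj; elim: k => [//|k IH]; rewrite iterS IH /=.
by rewrite {2}/reflection vj mulr0 scale0r subr0 /reflection vi mulr0 scale0r subr0.
Qed.

Lemma iter_reflectionD i j k u v : iter k (refl i \o refl j) (u + v) =
  iter k (refl i \o refl j) u + iter k (refl i \o refl j) v.
Proof. by elim: k => [//|k IH]; rewrite !iterS IH /= 2!reflectionD. Qed.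

Lemma iter_reflectionZ i j k c v : iter k (refl i \o refl j) (c *: v) =
  c *: iter k (refl i \o refl j) v.
Proof. by elim: k => [//|k IH]; rewrite !iterS IH /= 2!reflectionZ. Qed.

(** The power of r_i r_j fixes the plane of alpha_i and alpha_j by periodicity. For distinct i, j
    and finite m the form is nondegenerate on this plane, so V is its sum with the orthogonal
    complement, which both reflections fix pointwise. *)
Lemma reflection_relation i j v : iter (m i j) (refl i \o refl j) v = v.
Proof.
case: (eqVneq i j) => [<-|ij].
  case: cox => -> _ _ /=; exact: reflectionK.
case: (eqVneq (m i j) 0%N) => [-> //|mn0].
have fix_i : iter (m i j) (refl i \o refl j) (alpha i) = alpha i.
  by rewrite -{1}(dihedral_root0 i j) iter_dihedral_root dihedral_root_period //
     dihedral_root0.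
have fix_j : iter (m i j) (refl i \o refl j) (alpha j) = alpha j.
  have {1}-> : alpha j = - refl j (dihedral_root j i 0).
    by rewrite dihedral_root0 reflection_simple opprK.
  rewrite -scaleN1r iter_reflectionZ iter_dihedral_rootV.
  have mC : m i j = m j i by case: cox.
  rewrite mC dihedral_root_period ?[_ == i]eq_sym -?mC //.
  by rewrite dihedral_root0 reflection_simple scaleN1r opprK.
pose c := - cos_matrix R m i j.
have c2 : 1 - c ^+ 2 != 0.
  rewrite /c /cos_matrix (negPf mn0) opprK -sin2cos2 sqrf_eq0.
  exact/lt0r_neq0/sin_piV_gt0/coxeter_matrix_ge2.
pose a := B (alpha i) v; pose b := B (alpha j) v.
(* p and q are the coefficients of the orthogonal projection of v to the plane, by Cramer's rule
   with determinant 1 - c^2. *)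
pose p := (a + c * b) / (1 - c ^+ 2); pose q := (b + c * a) / (1 - c ^+ 2).
have -> : v = (v - (p *: alpha i + q *: alpha j)) + (p *: alpha i + q *: alpha j).
  by rewrite subrK.
rewrite iter_reflectionD iter_reflection_fix; first 1 last.
- rewrite bilinBr bilinDr !bilinZr bilin_simple_diag bilin_simple.
  rewrite -/a /p /q; have -> : cos_matrix R m i j = - c by rewrite opprK.
  by field.
- rewrite bilinBr bilinDr !bilinZr bilin_simple_diag bilin_simple.
  rewrite -/b /p /q cos_matrixC; have -> : cos_matrix R m i j = - c by rewrite opprK.
  by field.
by rewrite iter_reflectionD !iter_reflectionZ fix_i fix_j.
Qed.

End BilinearForm.

(** * Words and length *)

(* [mulgA] and [invgM] are stated for more general structures; rewriting with
   them in a group leaves a non-canonical path to the multiplication, which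
   [lia] does not identify. *)
Lemma group_mulA (W : groupType) (x y z : W) : (x * (y * z) = x * y * z)%g.
Proof. exact: mulgA. Qed.

Lemma group_invM (W : groupType) (x y : W) : ((x * y)^-1 = y^-1 * x^-1)%g.
Proof. exact: invgM. Qed.

Section Words.
Variables (W : groupType) (I : choiceType) (m : I -> I -> nat) (s : I -> W).
Hypothesis hWS : coxeter_system m s.
Implicit Types (u v : seq I) (w x y : W) (i j : I).
Local Open Scope group_scope.
Local Notation prod := (@word_prod W I s).

Lemma word_prod_nil : prod [::] = 1.
Proof. by rewrite /word_prod big_nil. Qed.

Lemma word_prod_cons i u : prod (i :: u) = s i * prod u.
Proof. by rewrite /word_prod big_cons. Qed.

Lemma word_prod_cat u v : prod (u ++ v) = prod u * prod v.
Proof. by rewrite /word_prod big_cat. Qed.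

Lemma word_prod1 i : prod [:: i] = s i.
Proof. by rewrite /word_prod big_seq1. Qed.

Lemma word_prod_rcons u i : prod (rcons u i) = prod u * s i.
Proof. by rewrite -cats1 word_prod_cat word_prod1. Qed.

Lemma word_prod_nseq u k : prod (flatten (nseq k u)) = prod u ^+ k.
Proof.
elim: k => [|k IH]; first by rewrite word_prod_nil.
by rewrite /= word_prod_cat IH expgS.
Qed.

Lemma word_prod_surj w : exists u, prod u = w.
Proof. by case: hWS. Qed.

Lemma coxeter_systemP u v : prod u = prod v <->
  clos_refl_sym_trans _ (coxeter_step m) u v.
Proof. by case: hWS. Qed.

Lemma coxeter_systemC : forall i j, m i j = m j i.
Proof. by case: hWS => -[]. Qed.

Lemma word_prod_step u v : coxeter_step m u v -> prod u = prod v.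
Proof. by move=> uv; apply/coxeter_systemP; apply: rst_step. Qed.

Lemma coxeter_relation i j : (s i * s j) ^+ m i j = 1.
Proof.
rewrite -word_prod_nil -(word_prod1 j) -word_prod_cons -word_prod_nseq.
apply: word_prod_step.
by have := CoxeterStep m [::] [::] i j; rewrite /= cats0.
Qed.

Lemma coxeter_gen_sq i : s i * s i = 1.
Proof. by have := coxeter_relation i i; case: hWS => -[-> _ _] _ _. Qed.

Lemma coxeter_genV i : (s i)^-1 = s i.
Proof. by apply: mulg1_eq; rewrite coxeter_gen_sq. Qed.

Lemma mulg_genK x i : x * s i * s i = x.
Proof. by rewrite -group_mulA coxeter_gen_sq mulg1. Qed.

Lemma word_prod_rev u : prod (rev u) = (prod u)^-1.
Proof.
elim: u => [|i u IH]; first by rewrite word_prod_nil invg1.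
by rewrite rev_cons word_prod_rcons IH word_prod_cons group_invM coxeter_genV.
Qed.

(** Every relator has even length. In [len_mul_gen] this excludes that w and w s_i have the same
    length. *)
Lemma word_prod_parity u v : prod u = prod v -> odd (size u) = odd (size v).
Proof.
move=> /coxeter_systemP; elim=> [_ _ [a b i j]|//|a b _ -> //|a b c _ -> _ -> //].
rewrite !size_cat !oddD; congr (_ (+) _).
suff -> : odd (size (flatten (nseq (m i j) [:: i; j]))) = false by [].
by elim: (m i j) => //= k ->.
Qed.

Fixpoint alternating i j k : seq I :=
  if k is k'.+1 then rcons (alternating j i k') j else [::].

Lemma size_alternating i j k : size (alternating i j k) = k.
Proof. by elim: k i j => //= k IH i j; rewrite size_rcons IH. Qed.

Lemma alternating_suffix i j k n :
  exists p, alternating i j (k + n) = p ++ alternating i j n.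
Proof.
elim: n i j => [|n IH] i j.
  by rewrite addn0; exists (alternating i j k); rewrite cats0.
by have [p /= ep] := IH j i; exists p; rewrite addnS /= ep rcons_cat.
Qed.

Lemma alternating_even i j k : prod (alternating i j k.*2) = (s i * s j) ^+ k.
Proof.
elim: k => [|k IH]; first exact: word_prod_nil.
by rewrite doubleS /= !word_prod_rcons IH expgSr group_mulA.
Qed.

Lemma alternating_odd i j k :
  prod (alternating i j k.*2.+1) = (s j * s i) ^+ k * s j.
Proof. by rewrite /= word_prod_rcons alternating_even. Qed.

(** This is the relator (s_i s_j)^m with one half moved to the other side; the two cases are the
    parities of m. *)
Lemma braid_relation i j :
  prod (alternating i j (m i j)) = prod (alternating j i (m i j)).
Proof.
have rel := coxeter_relation i j.
have inv k : ((s i * s j) ^+ k)^-1 = (s j * s i) ^+ k.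
  by rewrite -expVgn group_invM !coxeter_genV.
rewrite -(odd_double_half (m i j)) -addnn in rel *.
case: (odd _) rel; rewrite ?add0n ?add1n addnn => rel.
  rewrite !alternating_odd -inv.
  have /mulg1_eq -> : (s i * s j) ^+ (m i j)./2 *
      ((s i * s j) ^+ (m i j)./2 * (s i * s j)) = 1.
    by rewrite group_mulA -expgnDr addnn -expgSr.
  by rewrite group_mulA mulg_genK.
rewrite !alternating_even -inv; apply/esym/mulg1_eq.
by rewrite -expgnDr addnn.
Qed.

Definition reduced_expr w : seq I := xget [::] [set u | prod u = w /\ reduced s u]%classic.

Definition len w := size (reduced_expr w).

Lemma reduced_exprP w : prod (reduced_expr w) = w /\ reduced s (reduced_expr w).
Proof.
apply: (@xgetPex _ [::] [set u | prod u = w /\ reduced s u]%classic).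
have [u0 <-] := word_prod_surj w.
pose P n := `[< exists2 u, prod u = prod u0 & size u = n >].
have exP : exists n, P n by exists (size u0); apply/asboolP; exists u0.
case: (ex_minnP exP) => n /asboolP[u pu su] nmin.
exists u; split=> // v pv; rewrite su; apply: nmin.
by apply/asboolP; exists v => //; rewrite pv.
Qed.

Lemma word_prod_reduced_expr w : prod (reduced_expr w) = w.
Proof. by case: (reduced_exprP w). Qed.

Lemma len_word_prod u : (len (prod u) <= size u)%N.
Proof.
by have [pu] := reduced_exprP (prod u); apply; rewrite pu.
Qed.

Lemma reducedE u : reduced s u <-> len (prod u) = size u.
Proof.
split=> [ru|lu v pv]; last by rewrite -lu -pv len_word_prod.
apply/eqP; rewrite eqn_leq len_word_prod ru //.
exact: word_prod_reduced_expr.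
Qed.

Lemma len1 : len 1 = 0%N.
Proof. by apply/eqP; rewrite -leqn0 -word_prod_nil len_word_prod. Qed.

Lemma len_eq0 w : len w = 0%N -> w = 1.
Proof.
move=> /size0nil e; by rewrite -(word_prod_reduced_expr w) e word_prod_nil.
Qed.

Lemma lenM x y : (len (x * y) <= len x + len y)%N.
Proof.
rewrite -{1}(word_prod_reduced_expr x) -{1}(word_prod_reduced_expr y).
by rewrite -word_prod_cat -size_cat len_word_prod.
Qed.

Lemma lenV x : len x^-1 = len x.
Proof.
have le y : (len y^-1 <= len y)%N.
  rewrite -{1}(word_prod_reduced_expr y) -word_prod_rev.
  by apply: leq_trans (len_word_prod _) _; rewrite size_rev.
by apply/eqP; rewrite eqn_leq le -{1}(invgK x) le.
Qed.

Lemma len_gen i : (len (s i) <= 1)%N.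
Proof. by rewrite -word_prod1 len_word_prod. Qed.

Lemma odd_len u : odd (len (prod u)) = odd (size u).
Proof. exact/word_prod_parity/word_prod_reduced_expr. Qed.

Lemma len_mul_gen w i :
  len (w * s i) = (len w).+1 \/ len w = (len (w * s i)).+1.
Proof.
have o : odd (len (w * s i)) = ~~ odd (len w).
  rewrite -(word_prod_reduced_expr w) -word_prod_rcons !odd_len size_rcons.
  by [].
have := lenM w (s i); have := lenM (w * s i) (s i); rewrite mulg_genK.
by have := len_gen i; lia.
Qed.

Lemma len_mul_gen_lt w i : (len w < len (w * s i))%N = ~~ (len (w * s i) < len w)%N.
Proof. by have := len_mul_gen w i; lia. Qed.

Lemma reduced_catl u v : reduced s (u ++ v) -> reduced s u.
Proof.
rewrite !reducedE word_prod_cat size_cat => h.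
by have := lenM (prod u) (prod v); have := len_word_prod u; have := len_word_prod v; lia.
Qed.

Lemma reduced_catr u v : reduced s (u ++ v) -> reduced s v.
Proof.
rewrite !reducedE word_prod_cat size_cat => h.
by have := lenM (prod u) (prod v); have := len_word_prod u; have := len_word_prod v; lia.
Qed.

Lemma exists_descent w : w <> 1 -> exists i, (len (w * s i) < len w)%N.
Proof.
have [pu ru] := reduced_exprP w; move=> w1.
case/lastP e : (reduced_expr w) => [|u i].
  by case: w1; rewrite -pu e word_prod_nil.
exists i; rewrite -{1}pu e word_prod_rcons mulg_genK.
by rewrite /len e size_rcons ltnS; apply: len_word_prod.
Qed.

(** Right descents in J are split off one at a time until none remains; v is then the shortest
    element of the coset w W_J. *)
Lemma parabolic_factor (J : I -> Prop) w : exists (v : W) (a : seq I),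
  [/\ forall i, i \in a -> J i, w = v * prod a, len w = (len v + size a)%N
    & forall i, J i -> (len v < len (v * s i))%N].
Proof.
have [n] := ubnP (len w); elim: n w => // n IH w /ltnSE lw.
have [[i [Ji li]]|noi] := pselect (exists i, J i /\ (len (w * s i) < len w)%N).
  have [|v [a [Ja wa la vJ]]] := IH (w * s i); first exact: leq_trans li lw.
  exists v, (rcons a i); split=> //.
  - by move=> j; rewrite mem_rcons inE => /predU1P[-> //|/Ja].
  - by rewrite word_prod_rcons group_mulA -wa mulg_genK.
  - rewrite size_rcons addnS -la.
    by have := len_mul_gen w i; lia.
exists w, [::]; split=> //; first by rewrite word_prod_nil mulg1.
  by rewrite addn0.
move=> i Ji; rewrite len_mul_gen_lt; apply/negP => li.
by apply: noi; exists i.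
Qed.

(** Neighbouring letters of a reduced word differ, so the word is determined from its right end: the
    appended i forces the last letter j, and so on. *)
Lemma alternating_reduced i j a : (forall h, h \in a -> h = i \/ h = j) ->
  reduced s (rcons a i) -> a = alternating i j (size a).
Proof.
have [n] := ubnP (size a); elim: n a i j => // n IH a i j /ltnSE.
case/lastP: a => [//|a h]; rewrite size_rcons => an Ja ra.
have [hi|hj] : h = i \/ h = j.
- by apply: Ja; rewrite mem_rcons mem_head.
- move: ra; rewrite reducedE hi !word_prod_rcons mulg_genK !size_rcons => e.
  by have := len_word_prod a; lia.
rewrite hj /=; congr rcons; apply: IH => //.
  by move=> k ka; case: (Ja k); rewrite ?mem_rcons ?inE ?ka ?orbT; auto.
by rewrite -hj; move: ra; rewrite -(cats1 _ i) => /reduced_catl.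
Qed.

(** If m is finite and k >= m, the suffix of length m + 1 is reduced too; but a braid move on its
    first m letters makes its last two letters equal, and they cancel. *)
Lemma alternating_reduced_bound i j k :
  reduced s (alternating i j k.+1) -> m i j = 0%N \/ (k < m i j)%N.
Proof.
move=> rk; case e: (m i j) => [|n]; [by left|right].
rewrite ltnNge -e; apply/negP => mk.
have [p ep] := alternating_suffix i j (k - m i j) (m i j).+1.
move: rk; rewrite -(subnK mk) -addnS ep => /reduced_catr.
rewrite reducedE /= size_rcons size_alternating word_prod_rcons.
rewrite (coxeter_systemC i j) braid_relation (coxeter_systemC j i) e.
rewrite /= word_prod_rcons mulg_genK => le.
by have := len_word_prod (alternating j i n); rewrite size_alternating le; lia.
Qed.

End Words.

(** * Roots and inversions *)

Section Representation.
Variables (R : realType) (W : groupType) (I : choiceType).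
Variables (m : I -> I -> nat) (s : I -> W).
Hypothesis hWS : coxeter_system m s.
Local Notation V := {malg R[I]}.
Local Notation alpha := (@simple_root R I).
Local Notation refl := (@reflection R I m).
Local Notation act := (@act R W I m s).
Local Notation prod := (@word_prod W I s).
Local Notation len := (@len W I s).
Local Notation roots := (@Defs.roots R W I m s).
Local Notation inv := (@inversions R W I m s).
Implicit Types (w x y z : W) (v a b : V) (i j : I) (c : R) (u : seq I).

Let cox : coxeter_matrix m. Proof. by case: hWS. Qed.

Local Opaque reflection.

Lemma foldr_nseq_pair (f : I -> V -> V) i j k v :
  foldr f v (flatten (nseq k [:: i; j])) = iter k (f i \o f j) v.
Proof. by elim: k => [//|k IH]; rewrite iterS -IH. Qed.

Lemma foldr_reflection_eq u1 u2 v : prod u1 = prod u2 ->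
  foldr refl v u1 = foldr refl v u2.
Proof.
move=> /(coxeter_systemP hWS); elim=> [_ _ [a b i j]|//|a b _ -> //|a b c _ -> _ -> //].
rewrite !foldr_cat; congr foldr; rewrite -[RHS](reflection_relation cox i j).
exact: foldr_nseq_pair.
Qed.

Lemma act_word_prod u v : act (prod u) v = foldr refl v u.
Proof.
apply: foldr_reflection_eq.
by apply: (@xgetPex _ [::] [set u' | prod u' = prod u]%classic); exists u.
Qed.

Lemma act1 v : act 1%g v = v.
Proof. by rewrite -(word_prod_nil s) act_word_prod. Qed.

Lemma actM x y v : act (x * y)%g v = act x (act y v).
Proof.
have [[u <-] [u' <-]] := (word_prod_surj hWS x, word_prod_surj hWS y).
by rewrite -word_prod_cat !act_word_prod foldr_cat.
Qed.

Lemma act_gen i v : act (s i) v = refl i v.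
Proof. by rewrite -word_prod1 act_word_prod. Qed.

Lemma actVK w v : act w^-1%g (act w v) = v.
Proof. by rewrite -actM mulVg act1. Qed.

Lemma actKV w v : act w (act w^-1%g v) = v.
Proof. by rewrite -actM mulgV act1. Qed.

Lemma actD w a b : act w (a + b) = act w a + act w b.
Proof.
have [u <-] := word_prod_surj hWS w; rewrite !act_word_prod.
by elim: u => //= i u ->; rewrite reflectionD.
Qed.

Lemma actZ w c a : act w (c *: a) = c *: act w a.
Proof.
have [u <-] := word_prod_surj hWS w; rewrite !act_word_prod.
by elim: u => //= i u ->; rewrite reflectionZ.
Qed.

Lemma actN w a : act w (- a) = - act w a.
Proof. by rewrite -scaleN1r actZ scaleN1r. Qed.

Lemma bilin_act w a b : bilin_form m (act w a) (act w b) = bilin_form m a b.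
Proof.
have [u <-] := word_prod_surj hWS w; rewrite !act_word_prod.
by elim: u => //= i u <-; rewrite bilin_reflection.
Qed.

Definition nonneg_vec v := forall i, 0 <= mcoeff i v.

Lemma nonneg_vecD a b : nonneg_vec a -> nonneg_vec b -> nonneg_vec (a + b).
Proof. by move=> a0 b0 i; rewrite mcoeffD addr_ge0. Qed.

Lemma nonneg_vecZ c a : 0 <= c -> nonneg_vec a -> nonneg_vec (c *: a).
Proof. by move=> c0 a0 i; rewrite mcoeffZ mulr_ge0. Qed.

Lemma nonneg_simple_root i : nonneg_vec (alpha i).
Proof. by move=> j; rewrite mcoeff_simple_root ler0n. Qed.

Lemma foldr_alternating i j n k :
  foldr refl (dihedral_root R m i j n) (alternating i j k) =
  if odd k then dihedral_root R m j i (n + k) else dihedral_root R m i j (n + k).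
Proof.
elim: k i j n => [|k IH] i j n; first by rewrite addn0.
by rewrite /= foldr_rcons reflection_dihedral_root // IH addnS addSn; case: odd.
Qed.

(* Tits: the word a of the factorization w = v a along {i, t}, t a descent of
   w, is alternating of length < m(i, t), so a alpha_i is a nonnegative
   combination of alpha_i and alpha_t, to both of which induction applies for
   the shorter element v. *)
Theorem act_simple_root_ge0 w i :
  (len w < len (w * s i)%g)%N -> nonneg_vec (act w (alpha i)).
Proof.
have [n] := ubnP (len w); elim: n w i => // n IH w i /ltnSE wn wi.
have [->|w1] := pselect (w = 1%g).
  by rewrite act1; apply: nonneg_simple_root.
have [t wt] := exists_descent hWS w1.
have [v [a [Ja wa la vJ]]] := parabolic_factor hWS (fun h => h = i \/ h = t) w.
have it : i != t by apply/eqP => it; move: wi; rewrite it; lia.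
have lenva : len w = (len v + len (prod a))%N /\ len (prod a) = size a.
  by have := lenM hWS v (prod a); rewrite -wa; have := len_word_prod hWS a; lia.
have vw : (len v < len w)%N.
  rewrite la -[X in (X < _)%N]addn0 ltn_add2l lt0n; apply/eqP => /size0nil a0.
  by move: (vJ t (or_intror erefl)) wt; rewrite wa a0 word_prod_nil mulg1; lia.
(* If s_i shortened the product of a, then w s_i = v (a s_i) would be shorter than w. *)
have rai : reduced s (rcons a i).
  rewrite (reducedE hWS) word_prod_rcons size_rcons.
  have := lenM hWS v (prod a * s i)%g; rewrite group_mulA -wa.
  by have := len_mul_gen hWS (prod a) i; lia.
have ea := alternating_reduced hWS Ja rai.
have mk : (m i t = 0 \/ size a < m i t)%N.
  case: (@alternating_reduced_bound _ _ _ _ hWS t i (size a)).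
  - by rewrite /= -ea.
  - by rewrite (coxeter_systemC hWS); left.
  - by rewrite (coxeter_systemC hWS); right.
have v_i := IH v i (leq_trans vw wn) (vJ i (or_introl erefl)).
have v_t := IH v t (leq_trans vw wn) (vJ t (or_intror erefl)).
rewrite wa actM act_word_prod ea -(dihedral_root0 R m i t) foldr_alternating add0n.
case: ifP => _; rewrite dihedral_rootE actD !actZ; apply: nonneg_vecD;
  apply: nonneg_vecZ => //.
all: apply: chebyshevU_ge0 => //; try by rewrite // eq_sym.
all: rewrite ?(coxeter_systemC hWS t i) //.
all: by case: mk => [|/ltnW]; [left | right].
Qed.

Lemma act_mul_gen_simple w i : act (w * s i)%g (alpha i) = - act w (alpha i).
Proof. by rewrite actM act_gen reflection_simple // actN. Qed.

Lemma act_simple_root_le0 w i :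
  (len (w * s i)%g < len w)%N -> nonneg_vec (- act w (alpha i)).
Proof.
move=> wi; rewrite -act_mul_gen_simple; apply: act_simple_root_ge0.
by rewrite (mulg_genK hWS).
Qed.

Lemma root_act_simple w i : roots (act w (alpha i)).
Proof. by exists w, i. Qed.

Lemma root_simple i : roots (alpha i).
Proof. by rewrite -(act1 (alpha i)); apply: root_act_simple. Qed.

Lemma root_act w a : roots a -> roots (act w a).
Proof. by move=> [x [i ->]]; rewrite -actM; apply: root_act_simple. Qed.

Lemma rootN a : roots a -> roots (- a).
Proof. by move=> [x [i ->]]; rewrite -act_mul_gen_simple; apply: root_act_simple. Qed.

Lemma bilin_root a : roots a -> bilin_form m a a = 1.
Proof. by move=> [x [i ->]]; rewrite bilin_act bilin_simple_diag. Qed.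

Lemma root_sign a : roots a -> nonneg_vec a \/ nonneg_vec (- a).
Proof.
move=> [w [i ->]].
by have [e|e] := len_mul_gen hWS w i; [left; apply: act_simple_root_ge0|
  right; apply: act_simple_root_le0]; rewrite ?e.
Qed.

Lemma nonneg_vec_anti a : nonneg_vec a -> nonneg_vec (- a) -> a = 0.
Proof.
move=> a0 a1; apply/malgP => i; rewrite mcoeff0; apply/eqP; rewrite eq_le a0.
by have := a1 i; rewrite mcoeffN oppr_ge0 => ->.
Qed.

Lemma root_not_both a : roots a -> nonneg_vec a -> ~ nonneg_vec (- a).
Proof.
move=> ra a0 a1; have := bilin_root ra; rewrite (nonneg_vec_anti a0 a1).
by rewrite -(scale0r (0 : V)) bilinZl mul0r => /esym/eqP; rewrite oner_eq0.
Qed.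

Lemma inversionsP w a :
  inv w a <-> [/\ roots a, nonneg_vec a & nonneg_vec (- act w^-1%g a)].
Proof.
split=> [[[ra a0] [b [rb b0] <-]]|[ra a0 a1]]; first by rewrite opprK.
split=> //; exists (- act w^-1%g a); last by rewrite opprK.
by split=> //; apply/rootN/root_act.
Qed.

(** r_i changes only the coefficient of alpha_i. If r_i a is negative, all other coefficients of a
    vanish, and B(a, a) = 1 leaves only a = alpha_i. *)
Lemma reflection_pos_root i a : roots a -> nonneg_vec a -> a <> alpha i ->
  nonneg_vec (refl i a).
Proof.
move=> ra a0 ai.
have rr : roots (refl i a) by rewrite -act_gen; apply: root_act.
have [//|r0] := root_sign rr; case: ai.
have ea : a = mcoeff i a *: alpha i.
  apply/malgP => j; rewrite mcoeffZ mcoeff_simple_root.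
  case: eqVneq => [<-|ij]; first by rewrite mulr1.
  rewrite mulr0; apply/eqP; rewrite eq_le a0.
  by have := r0 j; rewrite mcoeffN oppr_ge0 mcoeff_reflection_neq // => ->.
have := bilin_root ra; rewrite ea bilinZl bilinZr // bilin_simple_diag // mulr1.
rewrite -expr2 => /eqP; rewrite sqrf_eq1 => /orP[] /eqP c1.
  by rewrite c1 scale1r.
by have := a0 i; rewrite c1 oppr_ge0 ler10.
Qed.

Lemma act_simple_root_le0P w i :
  nonneg_vec (- act w (alpha i)) <-> (len (w * s i)%g < len w)%N.
Proof.
split=> [w0|]; last exact: act_simple_root_le0.
apply/negPn; rewrite -(len_mul_gen_lt hWS) //; apply/negP => /act_simple_root_ge0.
by move=> /(root_not_both (root_act_simple w i)).
Qed.

Lemma len_mul_gen_le w i : (len (s i * w)%g < len w)%N <->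
  nonneg_vec (- act w^-1%g (alpha i)).
Proof.
rewrite act_simple_root_le0P -(lenV hWS (s i * w)%g) -(lenV hWS w).
by rewrite group_invM (coxeter_genV hWS).
Qed.

(** r_i permutes the positive roots other than alpha_i, so the only new inversion is w alpha_i. *)
Lemma inversions_mul_gen w i : (len w < len (w * s i)%g)%N ->
  inv (w * s i)%g = (inv w `|` [set act w (alpha i)])%classic.
Proof.
move=> wi; apply/seteqP; split=> a.
  move=> /inversionsP[ra a0]; rewrite group_invM (coxeter_genV hWS) // actM act_gen => a1.
  have [->|aw] := pselect (a = act w (alpha i)); [by right|left].
  apply/inversionsP; split=> //.
  have rw : roots (act w^-1%g a) by apply: root_act.
  have [w0|//] := root_sign rw.
  have /root_not_both : roots (refl i (act w^-1%g a)) by rewrite -act_gen; apply: root_act.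
  case=> //; apply: reflection_pos_root => // e; apply: aw.
  by rewrite -e actKV.
move=> [/inversionsP[ra a0 a1]|/= ->]; apply/inversionsP; split=> //.
- rewrite group_invM (coxeter_genV hWS) // actM act_gen -reflectionN //.
  apply: reflection_pos_root => //; first exact/rootN/root_act.
  move=> e; have := act_simple_root_ge0 wi; rewrite -e actN actKV.
  exact: root_not_both.
- exact: root_act_simple.
- exact: act_simple_root_ge0.
- by rewrite group_invM (coxeter_genV hWS) // actM actVK act_gen reflection_simple // opprK;
    apply: nonneg_simple_root.
Qed.

Lemma inversions1 : inv 1%g = set0.
Proof.
apply/seteqP; split=> // a /inversionsP[ra a0].
by rewrite invg1 act1 => /(root_not_both ra a0).
Qed.

Lemma finite_inversions w : finite_set (inv w).
Proof.
have [n] := ubnP (len w); elim: n w => // n IH w /ltnSE wn.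
have [->|/(exists_descent hWS)[i wi]] := pselect (w = 1%g).
  by rewrite inversions1.
rewrite -(mulg_genK hWS w i) inversions_mul_gen ?(mulg_genK hWS) //.
rewrite finite_setU; split; last exact: finite_set1.
exact/IH/leq_trans/wn.
Qed.

Lemma inversions_len_add x z : len (x * z)%g = (len x + len z)%N ->
  inv x `<=` inv (x * z)%g.
Proof.
have [n] := ubnP (len z); elim: n z => // n IH z /ltnSE zn xz.
have [->|/(exists_descent hWS)[i zi]] := pselect (z = 1%g).
  by rewrite mulg1.
have := len_mul_gen hWS z i; have := len_mul_gen hWS (x * z)%g i.
have := lenM hWS x (z * s i)%g; rewrite group_mulA => h1 h2 h3.
have xzi : len (x * z * s i)%g = (len x + len (z * s i)%g)%N by lia.
rewrite -[(x * z)%g](mulg_genK hWS _ i) inversions_mul_gen ?(mulg_genK hWS) //; last by lia.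
rewrite -group_mulA in xzi *.
by move=> a ax; left; move: a ax; apply: IH => //; lia.
Qed.

(** By induction on the length of x: if x = x' s_i with x' shorter and y = x' z, the root x' alpha_i
    is an inversion of y, so z^-1 makes alpha_i negative and s_i z is shorter than z. *)
Lemma inversions_subset x y : inv x `<=` inv y <->
  exists2 z, y = (x * z)%g & len y = (len x + len z)%N.
Proof.
split; last by move=> [z -> /inversions_len_add].
have [n] := ubnP (len x); elim: n x => // n IH x /ltnSE xn xy.
have [->|/(exists_descent hWS)[i xi]] := pselect (x = 1%g).
  by exists y; rewrite ?mul1g ?(len1 hWS).
have ex := mulg_genK hWS x i.
have xi' : (len (x * s i)%g < len (x * s i * s i)%g)%N by rewrite ex.
have ix := inversions_mul_gen xi'; rewrite ex in ix.
have iy : inv (x * s i)%g `<=` inv y by apply: subset_trans xy; rewrite ix; left.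
have [z ez lz] := IH _ (leq_trans xi xn) iy.
have /xy/inversionsP[_ _] : inv x (act (x * s i)%g (alpha i)) by rewrite ix; right.
rewrite -actM ez group_invM mulgVK => /len_mul_gen_le zi.
exists (s i * z)%g; first by rewrite group_mulA.
have := len_mul_gen hWS x i; have := lenM hWS x (s i * z)%g.
by rewrite group_mulA -ez; lia.
Qed.

Lemma inversions_inj : injective inv.
Proof.
move=> x y xy.
have /inversions_subset[z ez e1] : inv x `<=` inv y by rewrite xy.
have /inversions_subset[z' _ e2] : inv y `<=` inv x by rewrite xy.
have z0 : len z = 0%N by lia.
by rewrite ez (len_eq0 hWS z0) mulg1.
Qed.

Lemma inversions_cat u1 u2 : reduced s (u1 ++ u2) ->
  inv (prod u1) `<=` inv (prod (u1 ++ u2)).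
Proof.
move=> r; rewrite word_prod_cat; apply: inversions_len_add.
have /(reducedE hWS) r1 := reduced_catl hWS r.
have /(reducedE hWS) r2 := reduced_catr hWS r.
by rewrite -word_prod_cat r1 r2 -size_cat; apply/(reducedE hWS).
Qed.

End Representation.

(** * Parabolic subgroups and joins *)

Section FiniteUnions.

Lemma finite_set_nat_bound (A : set nat) :
  finite_set A -> exists n, forall k, A k -> (k <= n)%N.
Proof.
move=> /finite_seqP[l ->]; exists (\max_(k <- l) k)%N => k /= kl.
exact: (leq_bigmax_seq (F := id)).
Qed.

Lemma finite_sub_chain (T : choiceType) (F : nat -> set T) (A : set T) :
  (forall k, F k `<=` F k.+1) -> finite_set A -> A `<=` \bigcup_k F k ->
  exists k, A `<=` F k.
Proof.
move=> FS /finite_seqP[l ->] lF.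
have mono i j : (i <= j)%N -> F i `<=` F j.
  move=> /subnK <-; elim: (j - i)%N => [//|n IH]; rewrite addSn.
  exact/(subset_trans IH)/FS.
elim: l lF => [|x l IH] lF; first by exists 0%N => x; rewrite /= in_nil.
have [|k lk] := IH; first by move=> y yl; apply: lF; rewrite /= inE; apply/orP; right.
have [k' _ xk'] := lF x (mem_head x l).
exists (maxn k k') => y /=; rewrite inE => /predU1P[->|/lk yk].
  exact/mono/xk'/leq_maxr.
exact/mono/yk/leq_maxl.
Qed.

End FiniteUnions.

Section Parabolic.
Variables (R : realType) (W : groupType) (I : choiceType).
Variables (m : I -> I -> nat) (s : I -> W).
Hypothesis hWS : coxeter_system m s.
Local Notation V := {malg R[I]}.
Local Notation alpha := (@simple_root R I).
Local Notation refl := (@reflection R I m).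
Local Notation act := (@act R W I m s).
Local Notation prod := (@word_prod W I s).
Local Notation len := (@len W I s).
Local Notation roots := (@Defs.roots R W I m s).
Local Notation inv := (@inversions R W I m s).
Implicit Types (w x y z : W) (v a b : V) (i j : I) (c : R) (u : seq I) (J : set I).

Local Opaque reflection.

Lemma parabolicP J w : parabolic s J w <->
  exists2 u, (forall i, i \in u -> J i) & prod u = w.
Proof.
split=> [|[u Ju <-]]; last first.
  move=> H [[H1 HV] JH]; elim: u Ju => [|i u IH] Ju; first by rewrite word_prod_nil.
  rewrite word_prod_cons -[prod u]invgK.
  apply: (HV (s i) _ _); first by apply: JH; exists i => //; apply: Ju; exact: mem_head.
  rewrite -[_^-1%g]mul1g; apply: HV => //; apply: IH => j ju; apply: Ju.
  by rewrite inE ju orbT.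
apply: (@smallest_sub _ _ _
  [set w | exists2 u, (forall i, i \in u -> J i) & prod u = w]).
  split=> [|x y [u1 J1 <-] [u2 J2 <-]]; first by exists [::]; rewrite ?word_prod_nil.
  exists (u1 ++ rev u2); last by rewrite word_prod_cat (word_prod_rev hWS).
  by move=> i; rewrite mem_cat mem_rev => /orP[/J1|/J2].
move=> _ [i Ji <-]; exists [:: i]; last by rewrite word_prod1.
by move=> j; rewrite inE => /eqP ->.
Qed.

Lemma parabolic1 J : parabolic s J 1%g.
Proof. by apply/parabolicP; exists [::]; rewrite ?word_prod_nil. Qed.

Lemma parabolic_mul_gen J j w : J j -> parabolic s J w -> parabolic s J (s j * w)%g.
Proof.
move=> Jj /parabolicP[u Ju <-]; apply/parabolicP; exists (j :: u).
  by move=> i; rewrite inE => /predU1P[->|/Ju].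
by rewrite word_prod_cons.
Qed.

Lemma mcoeff_act_parabolic J w v i : parabolic s J w -> ~ J i ->
  mcoeff i (act w v) = mcoeff i v.
Proof.
move=> /parabolicP[u Ju <-] nJi; rewrite act_word_prod //.
elim: u Ju => //= j u IH Ju; rewrite mcoeff_reflection_neq.
  by apply: IH => k ku; apply: Ju; rewrite inE ku orbT.
by apply/eqP => ji; apply: nJi; rewrite -ji; apply/Ju/mem_head.
Qed.

Lemma parabolicV J w : parabolic s J w -> parabolic s J w^-1%g.
Proof.
move=> /parabolicP[u Ju <-]; apply/parabolicP; exists (rev u).
  by move=> i; rewrite mem_rev => /Ju.
exact: (word_prod_rev hWS).
Qed.

Lemma act_sum w (l : seq I) (f : I -> V) :
  act w (\sum_(i <- l) f i) = \sum_(i <- l) act w (f i).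
Proof.
elim: l => [|i l IH]; last by rewrite !big_cons actD // IH.
by rewrite !big_nil -(scale0r (0 : V)) actZ // !scale0r.
Qed.

(** The scalar [c] is 1 in [act_cone_ge0] and -1 in [act_cone_le0]. *)
Lemma act_cone w c a : nonneg_vec a ->
  (forall j, mcoeff j a != 0 -> nonneg_vec (c *: act w (alpha j))) ->
  nonneg_vec (c *: act w a).
Proof.
move=> a0 wa; rewrite [a in act w a]monalgE act_sum scaler_sumr.
rewrite big_seq; elim/big_ind: _ => [i|b1 b2|j ja]; first by rewrite mcoeff0.
  exact: nonneg_vecD.
have -> : mkmalgU j (mcoeff j a) = mcoeff j a *: alpha j.
  by apply/malgP => k; rewrite mcoeffZ mcoeffU mcoeff_simple_root mulr_natr.
rewrite actZ // scalerA mulrC -scalerA; apply: nonneg_vecZ => //.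
by apply: wa; rewrite mcoeff_neq0.
Qed.

Lemma act_cone_ge0 w a : nonneg_vec a ->
  (forall j, mcoeff j a != 0 -> nonneg_vec (act w (alpha j))) ->
  nonneg_vec (act w a).
Proof.
move=> a0 wa; rewrite -[act w a]scale1r; apply: act_cone => // j /wa.
by rewrite scale1r.
Qed.

Lemma act_cone_le0 w a : nonneg_vec a ->
  (forall j, mcoeff j a != 0 -> nonneg_vec (- act w (alpha j))) ->
  nonneg_vec (- act w a).
Proof.
move=> a0 wa; rewrite -scaleN1r; apply: act_cone => // j /wa.
by rewrite scaleN1r.
Qed.

(** W_J changes only the coefficients at J, so a nonzero coefficient outside J would stay
    positive. *)
Lemma parabolic_support J w a i : parabolic s J w -> nonneg_vec a ->
  nonneg_vec (- act w a) -> mcoeff i a != 0 -> J i.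
Proof.
move=> Jw a0 wa ai; apply: contrapT => nJi.
move/negP: ai; apply; rewrite eq_le a0.
by have := wa i; rewrite mcoeffN (mcoeff_act_parabolic _ Jw nJi) oppr_ge0 => ->.
Qed.

(** Every j in J is a left descent of w. Here w ranges over all of W, since the notion is also
    applied to prefixes of an infinite word. *)
Definition longest_on J w := forall j, J j -> nonneg_vec (- act w^-1%g (alpha j)).

Lemma finite_parabolic_longest J : finite_set (parabolic s J) ->
  exists2 w, parabolic s J w & longest_on J w.
Proof.
move=> fJ; have [n nmax] := finite_set_nat_bound (finite_image len fJ).
pose P k := `[< exists2 w, parabolic s J w & len w = k >].
have exP : exists k, P k.
  by exists (len 1%g); apply/asboolP; exists 1%g => //; exact: parabolic1.
have Pn k : P k -> (k <= n)%N by move=> /asboolP[w Jw <-]; apply: nmax; exists w.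
case: (ex_maxnP exP Pn) => k /asboolP[w Jw <-] wmax.
exists w => // j Jj; apply/(len_mul_gen_le R hWS).
have : (len (s j * w)%g <= len w)%N.
  by apply: wmax; apply/asboolP; exists (s j * w)%g => //; exact: parabolic_mul_gen.
have := len_mul_gen hWS w^-1%g j.
have e : len (w^-1 * s j)%g = len (s j * w)%g.
  by rewrite -(lenV hWS (s j * w)%g) group_invM (coxeter_genV hWS).
by rewrite e (lenV hWS w); lia.
Qed.

(** An inversion of x in W_J has its support in J, hence is a nonnegative combination of simple
    roots that w0 inverts. *)
Lemma longest_on_inversions J w0 x : longest_on J w0 -> parabolic s J x ->
  inv x `<=` inv w0.
Proof.
move=> Jw0 Jx a /inversionsP[//|ra a0 xa]; apply/inversionsP => //; split=> //.
apply: act_cone_le0 => // j ja; apply: Jw0.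
exact: parabolic_support (parabolicV Jx) a0 xa ja.
Qed.

(** * Joins of the covers z s_j of one element z *)

Section CosetJoin.
Variables (J : set I) (z w0 : W).
Hypothesis zJ : forall j, J j -> (len z < len (z * s j)%g)%N.
Hypothesis Jw0 : parabolic s J w0.
Hypothesis w0J : longest_on J w0.

Lemma coset_join_ge_root j : J j -> inv (z * w0)%g (act z (alpha j)).
Proof.
move=> Jj; apply/inversionsP => //; split.
- exact: root_act_simple.
- exact/act_simple_root_ge0/zJ.
- by rewrite group_invM actM // actVK //; apply: w0J.
Qed.

(** If z^-1 a is negative but w0^-1 z^-1 a is positive, then - z^-1 a is supported in J, and z maps
    it to a nonnegative vector since no j in J is a descent of z; so a would be negative. *)
Lemma coset_join_ge : inv z `<=` inv (z * w0)%g.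
Proof.
move=> a /inversionsP[//|ra a0 za]; apply/inversionsP => //; split=> //.
rewrite group_invM actM //.
have rb : roots (act z^-1%g a) by apply: root_act.
have [w0b|//] := root_sign hWS (root_act hWS w0^-1%g rb).
case: (root_not_both hWS ra a0).
have -> : - a = act z (- act z^-1%g a) by rewrite actN // actKV.
apply: act_cone_ge0 => // j jb; apply/act_simple_root_ge0/zJ => //.
apply: parabolic_support (parabolicV Jw0) za _ jb.
by rewrite actN // opprK.
Qed.

Lemma coset_join_ge_gen j : J j -> inv (z * s j)%g `<=` inv (z * w0)%g.
Proof.
move=> Jj; rewrite (inversions_mul_gen R hWS (zJ Jj)) => a [/coset_join_ge //|/= ->].
exact: coset_join_ge_root.
Qed.

(** For an inversion a of z w0 that is not one of z, the root z^-1 a is positive and supported in J,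
    so a is a nonnegative combination of the roots z alpha_j, all of which x inverts. *)
Lemma coset_join_least x : inv z `<=` inv x ->
  (forall j, J j -> inv x (act z (alpha j))) -> inv (z * w0)%g `<=` inv x.
Proof.
move=> zx xJ a /inversionsP[//|ra a0]; rewrite group_invM actM // => w0a.
have rb : roots (act z^-1%g a) by apply: root_act.
have [b0|b0] := root_sign hWS rb; last by apply/zx/inversionsP.
apply/inversionsP => //; split=> //.
have -> : a = act z (act z^-1%g a) by rewrite actKV.
rewrite -actM //; apply: act_cone_le0 => // j jb.
have Jj : J j by apply: parabolic_support (parabolicV Jw0) b0 w0a jb.
by rewrite actM //; have /inversionsP[] := xJ j Jj.
Qed.

End CosetJoin.

Definition is_join x y z := [/\ inv x `<=` inv z, inv y `<=` inv z &
  forall t, inv x `<=` inv t -> inv y `<=` inv t -> inv z `<=` inv t].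

Lemma inversions_subset_cover z x : inv z `<=` inv x -> z <> x ->
  exists i, (len z < len (z * s i)%g)%N /\ inv (z * s i)%g `<=` inv x.
Proof.
move=> /(inversions_subset R hWS)[c -> lc] zx.
have [pc rc] := reduced_exprP hWS c.
case ec : (reduced_expr s c) => [|i u].
  by case: zx; rewrite -pc ec word_prod_nil mulg1.
have cE : c = (s i * prod u)%g by rewrite -pc ec word_prod_cons.
have lenc : len c = (size u).+1 by rewrite /len ec.
have lzi := lenM hWS (z * s i)%g (prod u).
have := len_word_prod hWS u; have := len_mul_gen hWS z i.
move: lzi; rewrite -group_mulA -cE => lzi h1 h2.
exists i; split; first by lia.
rewrite {1}cE group_mulA; apply: inversions_len_add => //.
by rewrite -group_mulA -cE; lia.
Qed.

Hypothesis lf : forall J, finite_set J -> finite_set (parabolic s J).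

(* The join of two elements above z is found by induction on the distance from
   z to a common upper bound, from the joins of two covers of z (the argument
   of Bjorner, Edelman and Ziegler). *)
Lemma bounded_join z x y (v : W) : inv z `<=` inv x -> inv z `<=` inv y ->
  inv x `<=` inv v -> inv y `<=` inv v -> exists d, is_join x y d.
Proof.
have [n] := ubnP (len v - len z); elim: n z x y => // n IH z x y /ltnSE zn zx zy xv yv.
have [<-|nzx] := pselect (z = x); first by exists y; split.
have [<-|nzy] := pselect (z = y); first by exists x; split.
have [i [zi zix]] := inversions_subset_cover zx nzx.
have [j [zj zjy]] := inversions_subset_cover zy nzy.
have fJ : finite_set [set i; j] by apply: finite_set2.
have [w0 Jw0 w0J] := finite_parabolic_longest (lf fJ).
have zJ k : [set i; j] k -> (len z < len (z * s k)%g)%N by move=> [->|->].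
have di := coset_join_ge_gen zJ Jw0 w0J (or_introl erefl).
have dj := coset_join_ge_gen zJ Jw0 w0J (or_intror erefl).
have dle (u : W) : inv (z * s i)%g `<=` inv u -> inv (z * s j)%g `<=` inv u ->
    inv (z * w0)%g `<=` inv u.
  rewrite (inversions_mul_gen R hWS zi) (inversions_mul_gen R hWS zj) => iu ju.
  apply: (coset_join_least Jw0) => [a za|k [->|->]]; [apply: iu|apply: iu|apply: ju].
  - by left.
  - by right.
  - by right.
set d := (z * w0)%g in di dj dle.
have dv : inv d `<=` inv v.
  by apply: dle; [exact: subset_trans zix xv|exact: subset_trans zjy yv].
have lt_v k : (len z < len (z * s k)%g)%N -> inv (z * s k)%g `<=` inv v ->
    (len v - len (z * s k)%g < n)%N.
  by move=> zk /(inversions_subset R hWS)[c _ lv]; lia.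
(* The covers z s_i and z s_j are nearer to v than z. Induction from z s_i joins x with d, and
   induction from z s_j joins the result with y. *)
have [x' [xx' dx' x'le]] : exists x', is_join x d x'.
  by apply: (IH (z * s i)%g) => //; apply: lt_v => //; apply: subset_trans dv.
have x'v : inv x' `<=` inv v by apply: x'le.
have [y' [x'y' yy' y'le]] : exists y', is_join x' y y'.
  apply: (IH (z * s j)%g) => //; last exact: subset_trans dx'.
  by apply: lt_v => //; apply: subset_trans dv.
exists y'; split=> //; first exact: subset_trans x'y'.
move=> u xu yu; apply: y'le => //; apply: x'le => //; apply: dle.
  exact: subset_trans xu.
exact: subset_trans yu.
Qed.

Lemma exists_join x y : exists d, is_join x y d.
Proof.
have [[u <-] [u' <-]] := (word_prod_surj hWS x, word_prod_surj hWS y).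
have fJ : finite_set [set` u ++ u'] by apply: finite_seq.
have [w0 Jw0 w0J] := finite_parabolic_longest (lf fJ).
apply: (@bounded_join 1%g _ _ w0); rewrite ?inversions1 //.
- apply: longest_on_inversions w0J _; apply/parabolicP; exists u => // i iu.
  by rewrite /= mem_cat iu.
- apply: longest_on_inversions w0J _; apply/parabolicP; exists u' => // i iu.
  by rewrite /= mem_cat iu orbT.
Qed.

End Parabolic.

(** * The completed weak order *)

Section WeakOrderCompletion.
Variables (R : realType) (W : groupType) (I : choiceType).
Variables (m : I -> I -> nat) (s : I -> W).
Hypothesis hWS : coxeter_system m s.
Local Notation alpha := (@simple_root R I).
Local Notation act := (@act R W I m s).
Local Notation prod := (@word_prod W I s).
Local Notation len := (@len W I s).
Local Notation inv := (@inversions R W I m s).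
Local Notation Wb := (@Wbar R W I m s).
Local Notation invb := (@Wbar_inversions R W I m s).
Local Notation le := (weak_le R m s).
Local Notation inf_expr := {e : nat -> I | `[< inf_reduced s e >]}.
Implicit Types (w x y z : W) (X Y : Wb) (J : set I).

Local Open Scope quotient_scope.

Lemma inf_reduced_take (e : inf_expr) k : reduced s (mkseq (val e) k).
Proof.
case: k => [|k]; last by case: e => e /= /asboolP; apply.
by move=> v _.
Qed.

Lemma mkseq_cat (e : nat -> I) k n :
  mkseq e (k + n) = mkseq e k ++ mkseq (fun h : nat => e (k + h)%N) n.
Proof. by rewrite /mkseq iotaD map_cat add0n -[X in iota X n]addn0 iotaDl -map_comp. Qed.

(** The index k = 0 contributes the empty set, as the identity has no inversions. *)
Lemma inf_inversionsE (e : nat -> I) :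
  inf_inversions m s e = \bigcup_k inv (prod (mkseq e k)).
Proof.
apply/seteqP; split=> a [k]; first by exists k.
case: k => [|k] _ ak; last by exists k.+1.
by move: ak; rewrite word_prod_nil inversions1.
Qed.

Lemma inversions_prefix_chain (e : inf_expr) k :
  inv (prod (mkseq (val e) k)) `<=` inv (prod (mkseq (val e) k.+1)).
Proof.
rewrite -addn1 mkseq_cat; apply: inversions_cat => //.
by rewrite -mkseq_cat; apply: inf_reduced_take.
Qed.

Lemma Wbar_inversions_pi (e : inf_expr) :
  invb (inl (\pi_({eq_quot (@inf_equiv R W I m s)}) e)) = inf_inversions m s (val e).
Proof.
rewrite /Wbar_inversions.
have : @inf_equiv R W I m s (repr (\pi_({eq_quot (@inf_equiv R W I m s)}) e)) e.
  by apply/eqmodP; rewrite reprK.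
by move=> /asboolP.
Qed.

Lemma Wbar_cases X : (exists2 e : inf_expr, invb X = inf_inversions m s (val e) &
    X = inl (\pi_({eq_quot (@inf_equiv R W I m s)}) e)) \/
  (exists w, X = inr w).
Proof.
case: X => [c|w]; last by right; exists w.
by left; exists (repr (c : {eq_quot (@inf_equiv R W I m s)})); rewrite ?reprK.
Qed.

(** A prefix longer than w cannot lie below w. This separates infinite words from W in the proof of
    antisymmetry. *)
Lemma inf_inversions_not_subset (e : inf_expr) w :
  ~ inf_inversions m s (val e) `<=` inv w.
Proof.
set k := (len w).+1 => ew.
have : inv (prod (mkseq (val e) k)) `<=` inv w.
  by apply: subset_trans ew; rewrite inf_inversionsE => a ?; exists k.
move=> /(inversions_subset R hWS)[z _].
have /(reducedE hWS) -> := @inf_reduced_take e k.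
by rewrite size_mkseq /k; lia.
Qed.

Lemma weak_le_anti X Y : le X Y -> le Y X -> X = Y.
Proof.
move=> XY YX; have {XY YX}: invb X = invb Y by apply/seteqP.
have [[e eX ->]|[w ->]] := Wbar_cases X; have [[f fY ->]|[w' ->]] := Wbar_cases Y.
- rewrite !Wbar_inversions_pi => ef; congr inl.
  by apply/eqmodP; apply/asboolP.
- rewrite Wbar_inversions_pi => ew.
  by case: (@inf_inversions_not_subset e w'); rewrite ew.
- rewrite Wbar_inversions_pi => ew.
  by case: (@inf_inversions_not_subset f w); rewrite -ew.
- by move=> /= /inversions_inj -> .
Qed.

(** The inversion sets of the prefixes increase, so finitely many inversions of an infinite word
    occur in a single prefix. Through this compactness, facts about W pass to [Wbar]. *)
Lemma Wbar_finite_subset X (A : set {malg R[I]}) : finite_set A -> A `<=` invb X ->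
  exists2 w, A `<=` inv w & inv w `<=` invb X.
Proof.
have [[e -> _]|[w ->]] := Wbar_cases X; last by exists w.
rewrite inf_inversionsE => fA /(finite_sub_chain (@inversions_prefix_chain e) fA)[k Ak].
by exists (prod (mkseq (val e) k)) => // a ?; exists k.
Qed.

Lemma Wbar_below X a : invb X a -> exists2 w, inv w a & inv w `<=` invb X.
Proof.
move=> Xa; have [|a' -> //|w aw wX] := @Wbar_finite_subset X [set a].
  exact: finite_set1.
by exists w => //; apply: aw.
Qed.

(** The inversions of x and y together are finite in number, so some w in W below X bounds both, and
    the join property applies to w. *)
Lemma is_join_Wbar x y z X : is_join R m s x y z -> inv x `<=` invb X ->
  inv y `<=` invb X -> inv z `<=` invb X.
Proof.
move=> [_ _ zle] xX yX.
have [|a [/xX|/yX]//|w xyw wX] := @Wbar_finite_subset X (inv x `|` inv y).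
  by rewrite finite_setU; split; apply: finite_inversions.
by apply: subset_trans wX; apply: zle => a ?; apply: xyw; [left|right].
Qed.

(** * Limits of increasing chains in W *)

Section ChainLimit.
Variable c : nat -> W.
Hypothesis cS : forall n, inv (c n) `<=` inv (c n.+1).

Let chain_le (i j : nat) : (i <= j)%N -> inv (c i) `<=` inv (c j).
Proof.
move=> /subnK <-; elim: (j - i)%N => [//|n IH]; rewrite addSn.
exact/(subset_trans IH)/cS.
Qed.

(** Appending a reduced word of each quotient makes every word a prefix of the next; as lengths add
    along the chain, all of them are reduced. *)
Fixpoint chain_word n : seq I :=
  if n is k.+1 then chain_word k ++ reduced_expr s ((c k)^-1 * c k.+1)%g
  else reduced_expr s (c 0).

Let prod_chain_word n : prod (chain_word n) = c n.
Proof.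
elim: n => [|n IH] /=; first exact: (word_prod_reduced_expr hWS).
by rewrite word_prod_cat IH (word_prod_reduced_expr hWS) mulVKg.
Qed.

Let size_chain_word n : size (chain_word n) = len (c n).
Proof.
elim: n => [//|n IH] /=; rewrite size_cat IH.
have /(inversions_subset R hWS)[z -> ->] := @cS n.
by rewrite mulKg.
Qed.

Let chain_word_prefix (i j : nat) : (i <= j)%N ->
  exists u, chain_word j = chain_word i ++ u.
Proof.
move=> /subnK <-; elim: (j - i)%N => [|n [u IH]]; first by exists [::]; rewrite cats0.
by rewrite addSn /= IH -catA; eexists.
Qed.

Let chain_word_nth i0 (i j : nat) k : (k < size (chain_word i))%N ->
  (k < size (chain_word j))%N -> nth i0 (chain_word i) k = nth i0 (chain_word j) k.
Proof.
wlog ij : i j / (i <= j)%N.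
  move=> H; have [/H|/ltnW/H] := leqP i j; first exact.
  by move=> {}H ki kj; rewrite H.
have [u ->] := chain_word_prefix ij => ki _.
by rewrite nth_cat ki.
Qed.

Let reduced_chain_word n : reduced s (chain_word n).
Proof. by apply/(reducedE hWS); rewrite prod_chain_word size_chain_word. Qed.

Lemma chain_limit : exists X, invb X = \bigcup_n inv (c n).
Proof.
have [[N cN]|noN] := pselect (exists N, forall n, (N <= n)%N -> c n = c N).
  exists (inr (c N)); apply/seteqP; split=> [a aN|a [n _ an]]; first by exists N.
  have [/cN <- //|/ltnW nN] := leqP N n.
  exact: chain_le nN a an.
(* Comparable elements of equal length coincide, so a chain of bounded length is stationary. *)
have unbounded k : exists n, (k < size (chain_word n))%N.
  elim: k => [|k [n kn]].
    apply: contrapT => H; apply: noN; exists 0%N => n _.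
    have H' (j : nat) : c j = 1%g.
      apply: (len_eq0 hWS); apply/eqP; rewrite -leqn0 -size_chain_word leqNgt.
      by apply/negP => h; apply: H; exists j.
    by rewrite !H'.
  apply: contrapT => H; apply: noN; exists n => j nj.
  have /(inversions_subset R hWS)[z ez lz] := chain_le nj.
  rewrite ez (_ : z = 1%g) ?mulg1 //; apply: (len_eq0 hWS).
  have : ~ (k.+1 < size (chain_word j))%N by move=> h; apply: H; exists j.
  by rewrite !size_chain_word in kn *; lia.
have [N NP] := choice unbounded.
have i0 : I by have := NP 0%N; case: (chain_word (N 0%N)) => [//|i].
(* The words are prefixes of one another, so letter k can be read off any word longer than k; [N k]
   picks one. *)
pose e k := nth i0 (chain_word (N k)) k.
have eE n k : (k <= size (chain_word n))%N -> mkseq e k = take k (chain_word n).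
  move=> kn; apply: (@eq_from_nth _ i0) => [|j]; rewrite size_mkseq ?size_takel // => jk.
  rewrite nth_mkseq // nth_take //; apply: chain_word_nth (NP j) _.
  exact: leq_trans kn.
have er : inf_reduced s e.
  move=> k _; rewrite (eE (N k)) ?(ltnW (NP k)) //.
  by apply: (reduced_catl hWS (v := drop k (chain_word (N k)))); rewrite cat_take_drop.
exists (inl (\pi_({eq_quot (@inf_equiv R W I m s)}) (exist _ e (asboolT er)))).
rewrite Wbar_inversions_pi inf_inversionsE /=; apply/seteqP; split=> a [k _ ak].
  exists (N k) => //; rewrite -prod_chain_word -(cat_take_drop k (chain_word (N k))).
  apply: inversions_cat => //; first by rewrite cat_take_drop.
  by rewrite -eE // ltnW.
exists (size (chain_word k)) => //.
by rewrite (eE k) // take_size prod_chain_word.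
Qed.

End ChainLimit.

(** * Completeness for countable, locally finite systems *)

Section LocallyFinite.
Hypothesis lf : forall J, finite_set J -> finite_set (parabolic s J).
Hypothesis cI : countable [set: I].

Lemma countable_coxeter_group : countable [set: W].
Proof.
have /countable_injP[f finj] := cI.
apply/countable_injP; exists (fun w => choice.pickle (map f (reduced_expr s w))).
move=> x y _ _ /(pcan_inj (@choice.pickleK _))/inj_map fe.
rewrite -(word_prod_reduced_expr hWS x) -(word_prod_reduced_expr hWS y) fe //.
by move=> i j /finj -> //; rewrite in_setT.
Qed.

Lemma Wbar_lub (A : set Wb) : exists X, is_lub le A X.
Proof.
(* [g] lists the elements of W below some member of A. At an index that codes no such element its
   value is 1, which lies below everything. *)
have [g gA gP] : exists2 g : nat -> W,
    forall n, g n = 1%g \/ exists2 X, A X & inv (g n) `<=` invb X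
  & forall w, (exists2 X, A X & inv w `<=` invb X) -> exists n, g n = w.
  have /countable_injP[f finj] := countable_coxeter_group.
  pose P n w := f w = n /\ exists2 X, A X & inv w `<=` invb X.
  exists (fun n => xget 1%g [set w | P n w]) => [n|w wA].
    by case: xgetP => [w _ [_ ?]|_]; [right|left].
  exists (f w); case: xgetP => [w' _ [fw _]|/(_ w)]; last by case.
  by apply: finj; rewrite ?in_setT.
have [join joinP] := choice (fun xy : W * W => exists_join R hWS lf xy.1 xy.2).
(* c(n) is the join of g(0), ..., g(n). *)
pose c := fix c n := if n is k.+1 then join (c k, g k.+1) else g 0%N.
have cS n : inv (c n) `<=` inv (c n.+1) by case: (joinP (c n, g n.+1)).
have gc n : inv (g n) `<=` inv (c n).
  by case: n => [//|n]; case: (joinP (c n, g n.+1)).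
have [X XE] := chain_limit cS.
exists X; split=> [Y AY a /Wbar_below[w aw wY]|Y AY].
  have [|n gn] := gP w; first by exists Y.
  by rewrite XE; exists n => //; apply: gc; rewrite gn.
rewrite /le XE; apply: bigcup_sub => n _.
have gY k : inv (g k) `<=` invb Y.
  have [->|[Z /AY ZY gZ]] := gA k; first by rewrite inversions1.
  exact: subset_trans ZY.
by elim: n => [|n IH]; [exact: gY|exact: (is_join_Wbar (joinP (c n, g n.+1)) IH (gY _))].
Qed.

Lemma locally_finite_complete_lattice : complete_lattice le.
Proof.
split=> [X|X Y Z|X Y|A]; [by []|exact: subset_trans|exact: weak_le_anti|].
split; first exact: Wbar_lub.
(* A meet is the join of the set of lower bounds. *)
have [X [Xub Xle]] := Wbar_lub [set Y | forall a, A a -> le Y a].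
exists X; split=> [a Aa|Y YA]; last exact: Xub.
by apply: Xle => Y; apply.
Qed.

End LocallyFinite.

(** An element is determined by its inversion set, and A has finitely many subsets. *)
Lemma finite_inversions_subset (A : set {malg R[I]}) : finite_set A ->
  finite_set [set w | inv w `<=` A].
Proof.
move=> fA.
have -> : [set w | inv w `<=` A] =
    (fun w => fset_set (inv w)) @^-1` [set` fpowerset (fset_set A)].
  apply/seteqP; split=> w /=; rewrite fpowersetE -fset_set_sub //; exact: finite_inversions.
apply: finite_preimage; last exact: finite_fset.
move=> x y _ _ xy; apply: (@inversions_inj R _ _ _ _ hWS).
have fi := finite_inversions R hWS.
by rewrite -[LHS](fset_setK (fi x)) -[RHS](fset_setK (fi y)) xy.
Qed.

Lemma inversions_gen i : inv (s i) (alpha i).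
Proof.
apply/inversionsP => //; split; [exact: root_simple|exact: nonneg_simple_root|].
by rewrite (coxeter_genV hWS) act_gen // reflection_simple ?opprK;
  [apply: nonneg_simple_root|case: hWS].
Qed.

Lemma top_locally_finite X : infinite_set [set: W] -> (forall Y, le Y X) ->
  countable [set: I] /\ forall J, finite_set J -> finite_set (parabolic s J).
Proof.
move=> Winf Xtop.
have simpleX i : invb X (alpha i) by apply: (Xtop (inr (s i))); apply: inversions_gen.
(* A greatest element lying in W would contain all inversion sets in its own finite one, and W would
   be finite. *)
have [[e eX _]|[w wX]] := Wbar_cases X; last first.
  case: Winf; apply: sub_finite_set (finite_inversions_subset (finite_inversions R hWS w)).
  by move=> x _; have := Xtop (inr x); rewrite wX.
split.
  have /countable_injP[f finj] : countable (invb X).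
    rewrite eX inf_inversionsE; apply: bigcup_countable => // k _.
    exact/finite_set_countable/finite_inversions.
  apply/countable_injP; exists (fun i => f (alpha i)) => i j _ _ /finj.
  by rewrite !inE => /(_ (simpleX i) (simpleX j)) /simple_root_inj.
move=> J /(finite_image alpha) fJ.
have [|w Jw _] := Wbar_finite_subset fJ (X := X); first by move=> _ [i _ <-].
apply: sub_finite_set (finite_inversions_subset (finite_inversions R hWS w)).
move=> x Jx /=; apply: longest_on_inversions Jx => // j Jj.
by have /inversionsP[] : inv w (alpha j) by apply: Jw; exists j.
Qed.

Theorem complete_lattice_locally_finite : infinite_set [set: W] ->
  complete_lattice le <->
  countable [set: I] /\ forall J, finite_set J -> finite_set (parabolic s J).
Proof.
move=> Winf; split=> [[_ _ _ /(_ setT)[[X [Xub _]] _]]|[cI lf]].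
  by apply: (top_locally_finite Winf) => Y; apply: Xub.
exact: locally_finite_complete_lattice.
Qed.

End WeakOrderCompletion.

(** * Graphs of locally finite systems *)

Section LocallyFiniteGraph.
Variables (R : realType) (W : groupType) (I : choiceType).
Variables (m : I -> I -> nat) (s : I -> W).
Hypothesis hWS : coxeter_system m s.
Local Notation V := {malg R[I]}.
Local Notation alpha := (@simple_root R I).
Local Notation act := (@act R W I m s).
Local Notation prod := (@word_prod W I s).
Local Notation len := (@len W I s).
Local Notation B := (@bilin_form R I m).
Implicit Types (J : set I) (v : V).

Let cox : coxeter_matrix m. Proof. by case: hWS. Qed.

Local Opaque reflection.

Lemma parabolic_mul J x y :
  parabolic s J x -> parabolic s J y -> parabolic s J (x * y)%g.
Proof.
move=> /(parabolicP hWS)[u Ju <-] /(parabolicP hWS)[u' Ju' <-]; apply/(parabolicP hWS).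
exists (u ++ u'); last exact: word_prod_cat.
by move=> i; rewrite mem_cat => /orP[/Ju|/Ju'].
Qed.

(** The minimal representative x of the coset w W_J lies in W_J; any right descent of x is in J by
    [parabolic_support], against minimality, so x = 1. *)
Lemma parabolic_reduced J w : parabolic s J w ->
  exists u, [/\ forall i, i \in u -> J i, prod u = w & reduced s u].
Proof.
move=> Jw; have [x [a [Ja wE wl xJ]]] := parabolic_factor hWS J w.
have Jx : parabolic s J x.
  have -> : x = (w * prod (rev a))%g by rewrite (word_prod_rev hWS) wE mulgK.
  apply: parabolic_mul => //; apply/(parabolicP hWS).
  by exists (rev a) => // i; rewrite mem_rev => /Ja.
have x1 : x = 1%g.
  apply: contrapT => /(exists_descent hWS)[i xi].
  have Ji : J i.
    have xi0 := act_simple_root_le0 R hWS xi.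
    apply: (parabolic_support hWS Jx (nonneg_simple_root R i) xi0).
    by rewrite mcoeff_simple_root eqxx oner_eq0.
  by have := xJ i Ji; lia.
exists a; split=> //; first by rewrite wE x1 mul1g.
by apply/(reducedE hWS); move: wl; rewrite wE x1 mul1g (len1 hWS).
Qed.

(* If v were a nonzero vector of this kind, then w v >= v for all w in W_J,
   whereas the longest element of W_J maps v to a nonpositive vector. *)
Lemma finite_parabolic_antidominant J v : finite_set (parabolic s J) ->
  nonneg_vec v -> (forall j, mcoeff j v != 0 -> J j) ->
  (forall j, J j -> B (alpha j) v <= 0) -> v = 0.
Proof.
move=> fJ v0 vJ vB; have [w0 Jw0 w0J] := finite_parabolic_longest R hWS fJ.
have [u [Ju uE ru]] := parabolic_reduced (parabolicV hWS Jw0).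
(* A further letter j after a prefix u adds a nonnegative multiple of u alpha_j, which is
   nonnegative because u s_j is longer than u. *)
have le : nonneg_vec (act (prod u) v - v).
  elim/last_ind: u Ju ru {uE} => [|u j IH] Ju ru.
    by move=> i; rewrite word_prod_nil act1 // subrr mcoeff0.
  have Jj : J j by apply: Ju; rewrite mem_rcons mem_head.
  have ru' : reduced s u by move: ru; rewrite -cats1 => /(reduced_catl hWS).
  rewrite word_prod_rcons actM // act_gen //.
  have -> : reflection m j v = v + (- (2 * B (alpha j) v)) *: alpha j.
    by rewrite scaleNr.
  rewrite actD // actZ // addrAC; apply: nonneg_vecD.
    by apply: IH => // i iu; apply: Ju; rewrite mem_rcons inE iu orbT.
  apply: nonneg_vecZ; first by rewrite oppr_ge0 pmulr_rle0 // vB.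
  apply: act_simple_root_ge0 => //.
  move: ru ru'; rewrite !(reducedE hWS) word_prod_rcons size_rcons => -> ->.
  exact: ltnSn.
apply: nonneg_vec_anti => // i; rewrite mcoeffN oppr_ge0.
have : nonneg_vec (- act (prod u) v).
  rewrite uE; apply: act_cone_le0 => // j /vJ; exact: w0J.
by move=> /(_ i); have := le i; rewrite mcoeffB mcoeffN; lra.
Qed.

Lemma cos_pi3 : cos (pi / 3) = 1 / 2 :> R.
Proof.
have pi0 := pi_gt0 R; pose c := cos (pi / 3 : R).
have c0 : 0 < c by apply: cos_gt0_pihalf; apply/andP; split; lra.
have : cos (pi / 3 *+ 2 + pi / 3) = -1 :> R.
  by rewrite -cospi; congr cos; rewrite mulr2n; field.
rewrite cosD cos_mulr2n sin_mulr2n -/c.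
have -> : (c ^+ 2 *+ 2 - 1) * c - (c * sin (pi / 3)) *+ 2 * sin (pi / 3) =
  (c ^+ 2 *+ 2 - 1) * c - (c * (sin (pi / 3) ^+ 2)) *+ 2 by ring.
rewrite sin2cos2 -/c => e.
(* The triple angle formula reads 4 c^3 - 3 c = -1, and 4 c^3 - 3 c + 1 factors in this way. *)
have : (c + 1) * ((2 * c - 1) ^+ 2) = 0 by rewrite -[0](addrN (-1)) -{2}e; ring.
move/eqP; rewrite mulf_eq0 sqrf_eq0 => /orP[|] /eqP h; lra.
Qed.

Lemma coxeter_edge_cos i j : coxeter_edge m i j -> cos_matrix R m i j <= - (1 / 2).
Proof.
rewrite /cos_matrix => -[->|m3]; first by rewrite eqxx; lra.
case: eqP => [m0|_]; first by rewrite m0 in m3.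
rewrite lerN2 -cos_pi3; have pi0 := pi_gt0 R.
have m0 : 0 < (m i j)%:R :> R by rewrite ltr0n (leq_trans _ m3).
have m3' : 3 <= (m i j)%:R :> R by rewrite ler_nat.
have le : pi / (m i j)%:R <= pi / 3 :> R by rewrite ler_pM2l // lef_pV2 ?posrE.
have ge0 : 0 <= pi / (m i j)%:R :> R by rewrite divr_ge0 ?ltW.
move: le; rewrite le_eqVlt => /predU1P[->//|lt]; apply/ltW.
by rewrite ltr_cos // in_itv /=; apply/andP; split; lra.
Qed.

Lemma bilin_sumr v (l : seq I) (f : I -> V) :
  B v (\sum_(i <- l) f i) = \sum_(i <- l) B v (f i).
Proof.
elim: l => [|i l IH]; last by rewrite !big_cons bilinDr // IH.
by rewrite !big_nil -(scale0r (0 : V)) bilinZr // mul0r.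
Qed.

Hypothesis lf : forall J, finite_set J -> finite_set (parabolic s J).

(** Four neighbours of i would give the vector 2 alpha_i + sum of the alpha_j, the null root of
    affine D4 when the edges have label 3 and the neighbours are not joined. Cosine entries of at
    most -1/2 on edges make its products with the five simple roots nonpositive, against
    [finite_parabolic_antidominant]. *)
Lemma finite_coxeter_neighbours i : finite_set [set j | coxeter_edge m i j].
Proof.
apply: contrapT => /(infinite_set_fset 4%N)[X XN X4].
pose l := take 4 (enum_fset X).
have lsz : size l = 4%N by rewrite size_takel.
have lu : uniq l by apply/take_uniq/fset_uniq.
have le j : j \in l -> coxeter_edge m i j by move=> /mem_take /XN.
have il : i \notin l.
  by apply/negP => /le; case: cox => mii _ _; rewrite /coxeter_edge mii => -[].
pose v : V := 2 *: alpha i + \sum_(j <- l) alpha j.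
have v0 : nonneg_vec v.
  apply: nonneg_vecD; first by apply: nonneg_vecZ => //; apply: nonneg_simple_root.
  elim/big_ind: _ => [k|? ?|j _]; first by rewrite mcoeff0.
    exact: nonneg_vecD.
  exact: nonneg_simple_root.
have sum_le0 h (l' : seq I) : h \notin l' -> \sum_(j <- l') cos_matrix R m h j <= 0.
  move=> hl; rewrite big_seq; apply: sumr_le0 => j jl; apply: cos_matrix_le0 => //.
  by apply: contraNneq hl => ->.
have Bv h : B (alpha h) v = 2 * cos_matrix R m h i + \sum_(j <- l) cos_matrix R m h j.
  rewrite bilinDr // bilinZr // bilin_simple bilin_sumr; congr (_ + _).
  by apply: eq_bigr => j _; rewrite bilin_simple.
have : v = 0.
  apply: (@finite_parabolic_antidominant [set` i :: l]) => //.
  - exact/lf/finite_seq.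
  - move=> j; apply: contraR; rewrite /= inE negb_or => /andP[ji jl].
    rewrite mcoeffD mcoeffZ mcoeff_simple_root [i == j]eq_sym (negPf ji) mulr0 add0r.
    rewrite raddf_sum big_seq big1 // => k kl /=; rewrite mcoeff_simple_root.
    by case: eqP => // kj; rewrite -kj kl in jl.
  - move=> h /=; rewrite inE => /predU1P[->|hl]; rewrite Bv.
      rewrite cos_matrix_diag // mulr1.
      have : \sum_(j <- l) cos_matrix R m i j <= \sum_(j <- l) - (1 / 2).
        rewrite big_seq [leRHS]big_seq; apply: ler_sum => j /le.
        exact: coxeter_edge_cos.
      rewrite big_const_seq count_predT lsz /=; lra.
    rewrite (big_rem h) //= cos_matrix_diag //.
    have := sum_le0 h (rem h l); rewrite mem_rem_uniqF // => /(_ isT).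
    have := coxeter_edge_cos (le h hl); rewrite (cos_matrixC _ cox); lra.
move=> /(congr1 (mcoeff i)); rewrite mcoeff0 mcoeffD mcoeffZ mcoeff_simple_root eqxx.
rewrite mulr1 raddf_sum => /eqP; rewrite paddr_eq0 ?pnatr_eq0 //.
by apply: sumr_ge0 => j _; apply: nonneg_simple_root.
Qed.

(** By connectedness the balls around i0 exhaust the graph, and finite degrees make each ball
    finite. *)
Lemma locally_finite_irreducible_countable : irreducible m -> countable [set: I].
Proof.
move=> [[i0] conn].
pose ball := fix ball n := if n is k.+1 then
  ball k `|` \bigcup_(i in ball k) [set j | coxeter_edge m i j] else [set i0].
have fin n : finite_set (ball n).
  elim: n => [|n IH] /=; first exact: finite_set1.
  rewrite finite_setU; split=> //; apply: bigcup_finite => // i _.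
  exact: finite_coxeter_neighbours.
suff -> : [set: I] = \bigcup_n ball n.
  by apply: bigcup_countable => // n _; apply/finite_set_countable.
apply/seteqP; split=> // j _; have := conn i0 j.
rewrite clos_rt_rtn1_iff; elim=> [|x y xy _ [n _ nx]].
  by exists 0%N.
by exists n.+1 => //=; right; exists x.
Qed.

End LocallyFiniteGraph.

(** * Irreducible components *)

Section GeneratedSubgroup.
Variables (W : groupType) (A : set W).

Lemma generated_subgroup : subgroup (generated A).
Proof.
split=> [H [[]] //|x y Ax Ay H HA].
by case: (HA) => -[_ HV] _; apply: HV; [apply: Ax|apply: Ay].
Qed.

Definition generated_pred : pred W := fun w => `[< generated A w >].

Lemma generated_group_closed : group_closed generated_pred.
Proof.
have [G1 GV] := generated_subgroup.
split=> [|x y /asboolP Ax /asboolP Ay]; apply/asboolP => //.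
exact: GV.
Qed.

(** The subgroup as a group type of its own, so that it can serve as a factor of [weak_dprod]. *)
Definition generated_group := {w : W | generated_pred w}.
HB.instance Definition _ := SubChoice.on generated_group.
HB.instance Definition _ := SubChoice_isSubGroup.Build W generated_pred
  generated_group generated_group_closed.

End GeneratedSubgroup.

(** * The factor on a union of components *)

Section Factor.
Variables (W : groupType) (I : choiceType) (m : I -> I -> nat) (s : I -> W).
Hypothesis hWS : coxeter_system m s.
Variable P : pred I.
Hypothesis sepP : forall i j, P i -> ~~ P j -> m i j = 2%N.
Local Notation prod := (@word_prod W I s).
Local Notation WP := (generated_group (s @` [set` P])).
Local Notation IP := {i : I | P i}.

Lemma filter_flatten_nseq k (u : seq I) :
  filter P (flatten (nseq k u)) = flatten (nseq k (filter P u)).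
Proof. by elim: k => //= k <-; rewrite filter_cat. Qed.

(** A relator with both letters in P is kept, one with none becomes empty, and a mixed one, having m
    = 2, becomes i i; all have product 1. *)
Lemma word_prod_filter_step u v : coxeter_step m u v ->
  prod (filter P u) = prod (filter P v).
Proof.
case=> a b i j; rewrite !filter_cat !word_prod_cat filter_flatten_nseq.
rewrite word_prod_nseq (_ : _ ^+ _ = 1)%g ?mul1g //=.
have [Pi|Pi] := boolP (P i); have [Pj|Pj] := boolP (P j).
- by rewrite word_prod_cons word_prod1 coxeter_relation.
- by rewrite sepP // word_prod1 expg2 (coxeter_gen_sq hWS).
- by rewrite (coxeter_systemC hWS) sepP // word_prod1 expg2 (coxeter_gen_sq hWS).
- by rewrite word_prod_nil expg1n.
Qed.

Lemma word_prod_filter u v : prod u = prod v ->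
  prod (filter P u) = prod (filter P v).
Proof.
move=> /(coxeter_systemP hWS).
by elim=> [a b /word_prod_filter_step|//|a b _ -> //|a b c _ -> _ -> //].
Qed.

(** The projection of W onto W_P that kills the generators outside P; [word_prod_filter] makes it
    independent of the expression. *)
Definition factor w := prod (filter P (expression s w)).

Lemma factor_word_prod u : factor (prod u) = prod (filter P u).
Proof.
apply: word_prod_filter.
by apply: (@xgetPex _ [::] [set u' | prod u' = prod u]); exists u.
Qed.

Lemma factorM x y : factor (x * y)%g = (factor x * factor y)%g.
Proof.
have [[u <-] [u' <-]] := (word_prod_surj hWS x, word_prod_surj hWS y).
by rewrite -word_prod_cat !factor_word_prod filter_cat word_prod_cat.
Qed.

Lemma factor1 : factor 1%g = 1%g.
Proof. by rewrite -(word_prod_nil s) factor_word_prod word_prod_nil. Qed.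

Lemma factor_parabolic w : parabolic s [set` P] (factor w).
Proof.
apply/(parabolicP hWS); exists (filter P (expression s w)) => //.
by move=> i; rewrite mem_filter => /andP[].
Qed.

Lemma factor_id w : parabolic s [set` P] w -> factor w = w.
Proof.
move=> /(parabolicP hWS)[u Pu <-]; rewrite factor_word_prod.
by congr word_prod; apply/all_filterP/allP.
Qed.

(** Letters outside P commute with those in P, so they can all be moved to the right. *)
Lemma word_prod_filter_split u :
  prod u = (prod (filter P u) * prod (filter (predC P) u))%g.
Proof.
elim: u => [|i u IH]; first by rewrite word_prod_nil mulg1.
rewrite word_prod_cons {1}IH /=; case: (boolP (P i)) => Pi /=.
  by rewrite word_prod_cons group_mulA.
rewrite word_prod_cons !group_mulA; congr (_ * _)%g.
elim: {IH}u => [|j u IH] /=; first by rewrite word_prod_nil mul1g mulg1.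
case: ifP => // Pj; rewrite word_prod_cons -group_mulA -IH !group_mulA.
congr (_ * _)%g; have := coxeter_relation hWS j i; rewrite sepP // expg2.
by move=> /mulg1_eq <-; rewrite group_invM !(coxeter_genV hWS).
Qed.

Lemma simple_generated (a : IP) : generated_pred (s @` [set` P]) (s (val a)).
Proof. by apply/asboolP; apply: sub_gen_smallest; exists (val a) => //; exact: (valP a). Qed.

Definition factor_gen (a : IP) : WP := Sub (s (val a)) (simple_generated a).

Definition factor_matrix (a b : IP) := m (val a) (val b).

Lemma val_word_prod (u : seq IP) :
  val (word_prod factor_gen u) = prod (map val u).
Proof.
elim: u => [|a u IH]; first by rewrite !word_prod_nil val1.
by rewrite !word_prod_cons valM IH.
Qed.

Let restr : seq I -> seq IP := pmap insub.

(** A mixed relator restricts to i i, which is the relator of the pair (i, i) as m(i, i) = 1. *)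
Let restr_step u v : coxeter_step m u v ->
  clos_refl_sym_trans _ (coxeter_step factor_matrix) (restr u) (restr v).
Proof.
case=> a b i j; rewrite /restr !pmap_cat.
have -> k : pmap insub (flatten (nseq k [:: i; j])) =
    flatten (nseq k (pmap insub [:: i; j])) :> seq IP.
  by elim: k => //= k <-; case: insubP => [? _ _|_]; case: insubP.
rewrite /=; have [Pi|Pi] := boolP (P i); have [Pj|Pj] := boolP (P j).
- rewrite (insubT P Pi) (insubT P Pj) /=.
  exact/rst_step/(CoxeterStep factor_matrix _ _ (Sub i Pi) (Sub j Pj)).
- rewrite (insubT P Pi) (insubN IP Pj) /= sepP //=; apply: rst_step.
  have := CoxeterStep factor_matrix (pmap insub a) (pmap insub b) (Sub i Pi) (Sub i Pi).
  by rewrite /factor_matrix; case: hWS => -[-> _ _] _ _.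
- rewrite (insubN IP Pi) (insubT P Pj) /= (coxeter_systemC hWS) sepP //=; apply: rst_step.
  have := CoxeterStep factor_matrix (pmap insub a) (pmap insub b) (Sub j Pj) (Sub j Pj).
  by rewrite /factor_matrix; case: hWS => -[-> _ _] _ _.
- rewrite (insubN IP Pi) (insubN IP Pj) /=.
  have -> k : flatten (nseq k ([::] : seq IP)) = [::] by elim: k.
  exact: rst_refl.
Qed.

Lemma factor_coxeter_system : coxeter_system factor_matrix factor_gen.
Proof.
have [[mii mC mij] _ _] := hWS; split.
- split=> [a|a b|a b ab]; rewrite /factor_matrix; [exact: mii|exact: mC|].
  by apply: mij => /val_inj.
- move=> w; have /asboolP/(parabolicP hWS)[u Pu uE] := valP w.
  exists (restr u); apply/val_inj; rewrite val_word_prod -[RHS]uE.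
  rewrite pmap_filter; last exact: insubK.
  congr word_prod; apply/all_filterP/allP => i iu.
  have Pi : P i := Pu i iu; by rewrite /= (insubT P Pi).
move=> u v; split.
  move=> /(congr1 val); rewrite !val_word_prod => /(coxeter_systemP hWS) uv.
  (* A derivation in W between words over P restricts to one over P, since [restr] undoes [map val]
     at both ends. *)
  rewrite -[u](map_pK (@valK _ _ _)) -[v](map_pK (@valK _ _ _)) -/restr.
  elim: uv => [a b /restr_step //|a|a b _ ?|a b c _ ab _ bc].
  - exact: rst_refl.
  - exact: rst_sym.
  - exact: rst_trans ab bc.
move=> uv; apply/val_inj; rewrite !val_word_prod.
elim: uv => [_ _ [a b i j]|//|a b _ -> //|a b c _ -> _ -> //].
apply: (word_prod_step hWS); rewrite !map_cat map_flatten map_nseq.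
exact: CoxeterStep.
Qed.

Lemma val_parabolic_factor (J : set IP) w :
  parabolic factor_gen J w -> parabolic s (val @` J) (val w).
Proof.
move=> /(parabolicP factor_coxeter_system)[u Ju <-]; rewrite val_word_prod.
apply/(parabolicP hWS); exists (map val u) => // _ /mapP[a /Ju Ja ->].
by exists a.
Qed.

End Factor.

(** * Connected components of the Coxeter graph *)

Section Components.
Variables (W : groupType) (I : choiceType) (m : I -> I -> nat) (s : I -> W).
Hypothesis hWS : coxeter_system m s.
Local Notation prod := (@word_prod W I s).
Local Notation conn := (clos_refl_trans I (coxeter_edge m)).

Lemma connC i j : conn i j -> conn j i.
Proof.
elim=> [x y xy|x|x y z _ yx _ zy]; last exact: rt_trans zy yx.
  by apply: rt_step; rewrite /coxeter_edge (coxeter_systemC hWS).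
exact: rt_refl.
Qed.

(* On a nonempty set, [xget] does not depend on its default value, so this is
   constant on components. *)
Definition component_rep i := xget i [set j | conn i j].

Lemma conn_component_rep i : conn i (component_rep i).
Proof. by apply: (@xgetPex _ i [set j | conn i j]); exists i; apply: rt_refl. Qed.

Lemma component_rep_eq i j : component_rep i = component_rep j <-> conn i j.
Proof.
split=> [e|ij].
  apply: rt_trans (conn_component_rep i) _; rewrite e.
  exact/connC/conn_component_rep.
rewrite /component_rep; have -> : [set k | conn i k] = [set k | conn j k].
  by apply/seteqP; split=> k /= h; [apply: rt_trans (connC ij) h|apply: rt_trans ij h].
rewrite /xget; case: pselect => // -[]; exists j; apply/asboolP.
exact: rt_refl.
Qed.

Definition component k : pred I := fun i => component_rep i == k.

Lemma component_sep k i j : component k i -> ~~ component k j -> m i j = 2%N.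
Proof.
move=> /eqP ik jk; have ij : ~ conn i j.
  by move=> /component_rep_eq e; move/negP: jk; apply; rewrite /component -e ik.
have nedge : ~ coxeter_edge m i j by move=> e; apply: ij; apply: rt_step.
have : m i j <> 1%N.
  by case: hWS => -[_ _ +] _ _; apply => e; apply: ij; rewrite e; apply: rt_refl.
by move: nedge; rewrite /coxeter_edge; case: (m i j) => [|[|[|n]]] //= H; case: H; auto.
Qed.

End Components.

(** * The splitting of W along its components *)

Section ComponentDecomposition.
Variables (W : groupType) (K : choiceType) (m : K -> K -> nat) (s : K -> W).
Hypothesis hWS : coxeter_system m s.
Local Notation prod := (@word_prod W K s).
Local Notation P := (component m).
Local Notation conn := (clos_refl_trans K (coxeter_edge m)).
Local Notation sep := (component_sep hWS).
Local Notation G := (fun k => generated_group (s @` [set` P k])).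

(** The letters of a word that lie in the component of its first letter multiply to a factor of w,
    which is 1; deleting them shortens the word. *)
Lemma factor_eq1 w : (forall k, factor s (P k) w = 1%g) -> w = 1%g.
Proof.
have [u <-] := word_prod_surj hWS w.
have [n] := ubnP (size u); elim: n u => // n IH [|i u] /ltnSE un u1.
  exact: word_prod_nil.
set k := component_rep m i.
have Pi : P k i by apply/eqP.
have e : prod (i :: u) = prod (filter (predC (P k)) (i :: u)).
  rewrite {1}(word_prod_filter_split hWS (@sep k)).
  by rewrite -(factor_word_prod hWS (@sep k)) u1 mul1g.
rewrite e; apply: IH; last by move=> k'; rewrite -e; apply: u1.
by rewrite /= Pi /= size_filter; apply: leq_ltn_trans (count_size _ _) un.
Qed.

Lemma factor_neq k k' w : k != k' -> parabolic s [set` P k'] w ->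
  factor s (P k) w = 1%g.
Proof.
move=> kk' /(parabolicP hWS)[u Pu <-]; rewrite (factor_word_prod hWS (@sep k)).
rewrite (_ : filter _ _ = [::]) ?word_prod_nil //.
apply/eqP; rewrite -[_ == _]negbK -has_filter; apply/hasPn => i /Pu /eqP ik'.
by rewrite /component ik' eq_sym.
Qed.

Lemma prod_delta (l : seq K) k (x : K -> W) : uniq l ->
  (\prod_(h <- l) (if h == k then x h else 1) = if k \in l then x k else 1)%g.
Proof.
elim: l => [|h l IH] /=; first by rewrite big_nil.
move=> /andP[hl /IH {}IH]; rewrite big_cons IH inE eq_sym; case: eqVneq => [->|_] /=.
  by rewrite (negPf hl) mulg1.
by rewrite mul1g.
Qed.

(** The index k runs over all generators: if k represents no component, then [component m k] is
    empty and contributes a trivial group. *)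
Lemma component_isog : isog_weak_dprod W G.
Proof.
exists (fun w k =>
  exist _ (factor s (P k) w) (asboolT (factor_parabolic hWS (P := P k) w)) : G k).
split=> [x y k|]; first by apply/val_inj; rewrite valM /= (factorM hWS (@sep k)).
split.
- move=> w _; have [u <-] := word_prod_surj hWS w.
  apply: (@sub_finite_set _ _ [set` map (component_rep m) u]); last exact: finite_seq.
  move=> k /= wk; apply: contrapT => /negP ku; apply: wk; apply/val_inj => /=.
  rewrite (factor_word_prod hWS (@sep k)) (_ : filter _ _ = [::]) ?word_prod_nil //.
  apply/eqP; rewrite -[_ == _]negbK -has_filter; apply/hasPn => i iu.
  by apply: contra ku => /eqP <-; apply: map_f.
- move=> x y _ _ xy; apply: divg1_eq; apply: factor_eq1 => k.
  have {xy} xy : factor s (P k) x = factor s (P k) y.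
    by have := congr1 (fun g : forall k, G k => val (g k)) xy.
  apply: (@mulIg _ (factor s (P k) y)).
  by rewrite -(factorM hWS (@sep k)) mulgVK mul1g.
move=> g /finite_seqP[l0 gl0]; pose l := undup l0.
(* The preimage of g is the product of its finitely many nontrivial entries, each taken once. *)
exists (\prod_(h <- l) val (g h))%g => //.
apply: functional_extensionality_dep => k; apply/val_inj => /=.
rewrite (big_morph _ (factorM hWS (@sep k)) (factor1 hWS (@sep k))).
rewrite (eq_bigr (fun h => if h == k then val (g h) else 1%g)).
  rewrite prod_delta ?undup_uniq // mem_undup; case: ifPn => // kl0.
  have : ~ [set k | g k <> 1%g] k by rewrite gl0; apply/negP.
  by move=> /contrapT ->.
move=> h _; have /asboolP gh := valP (g h).
case: eqVneq => [hk|hk]; last by rewrite (factor_neq _ gh) // eq_sym.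
by rewrite hk in gh *; rewrite (factor_id hWS (@sep k)).
Qed.

Hypothesis lf : forall J : set K, finite_set J -> finite_set (parabolic s J).

Lemma component_factor k : finite_coxeter_group (G k) \/
  locally_finite_irreducible_coxeter_group (G k).
Proof.
have sys := factor_coxeter_system hWS (@sep k).
have [fin|inf] := pselect (finite_set [set: G k]).
  left; split=> //.
  by exists {i : K | P k i}, (factor_matrix m (P := P k)), (factor_gen s (P := P k)).
right; exists {i : K | P k i}, (factor_matrix m (P := P k)), (factor_gen s (P := P k)).
split=> //.
  split=> // J fJ; apply: (@sub_finite_set _ _ (val @^-1` (parabolic s (val @` J)))).
    by move=> w; apply: (val_parabolic_factor hWS (@sep k)).
  apply: finite_preimage; first by move=> x y _ _ /val_inj.
  exact/lf/finite_image.
split.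
  (* An empty component would generate the trivial group, which is not infinite. *)
  apply: contrapT => empty; apply: inf; apply: (@sub_finite_set _ _ [set 1%g]).
    move=> w _ /=; have [u <-] := word_prod_surj sys w.
    by case: u => [|a u]; [rewrite word_prod_nil | case: empty; exists].
  exact: finite_set1.
move=> a [j Pj].
have : conn (val a) j.
  by apply/(component_rep_eq hWS); rewrite (eqP Pj) (eqP (valP a)).
(* A path that ends in the component stays inside it, so it lifts to the subtype. *)
rewrite clos_rt_rtn1_iff => aj; elim: aj Pj => [|y z yz ay IH] Pz.
  by rewrite (_ : exist _ _ _ = a); [exact: rt_refl|apply/val_inj].
have Py : P k y.
  apply/eqP; rewrite -(eqP Pz); apply/(component_rep_eq hWS); exact: rt_step.
by apply: rt_trans (IH Py) _; apply: rt_step.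
Qed.

End ComponentDecomposition.

(** * Weak direct products *)

Section WeakProduct.
Variables (W : groupType) (K : countType) (G : K -> groupType).
Variable f : W -> forall k, G k.
Hypothesis fM : forall x y k, f (x * y)%g k = (f x k * f y k)%g.
Hypothesis fbij : set_bij [set: W] (weak_dprod G) f.

Let f_inj : injective f.
Proof. by case: fbij => _ finj _ x y; apply: finj; rewrite in_setT. Qed.

Let f1 k : f 1%g k = 1%g.
Proof. by apply: (@mulgI _ (f 1%g k)); rewrite -fM !mulg1. Qed.

Let fV x k : f x^-1%g k = (f x k)^-1%g.
Proof. by apply/esym/mulg1_eq; rewrite -fM mulgV f1. Qed.

Let f_support w : finite_set [set k | f w k <> 1%g].
Proof. by case: fbij => fun_f _ _; apply: fun_f. Qed.

(** When k0 is added to l, g is recovered from its entry at k0 and from g with this entry replaced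
    by 1. *)
Lemma finite_restricted_prod (H : forall k, set (G k)) (l : seq K) :
  (forall k, finite_set (H k)) -> (forall k, H k 1%g) ->
  finite_set [set g : forall k, G k | forall k, H k (g k) /\ (k \notin l -> g k = 1%g)].
Proof.
move=> fH H1; elim: l => [|k0 l IH].
  apply: (@sub_finite_set _ _ [set (fun k => 1%g)]); last exact: finite_set1.
  by move=> g /= g1; apply: functional_extensionality_dep => k; apply: (g1 k).2.
apply: sub_finite_set (finite_image (fun p => dfwith p.2 p.1) (finite_setX (fH k0) IH)).
move=> g /= gP; exists (g k0, dfwith g (1%g : G k0)) => /=.
  split; first exact: (gP k0).1.
  move=> k; split; first by case: dfwithP => // j _; apply: (gP j).1.
  case: dfwithP => // j k0j jl; apply: (gP j).2.
  by rewrite inE negb_or eq_sym k0j.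
apply: functional_extensionality_dep => k.
have [<-|kk0] := eqVneq k0 k; first by rewrite dfwith_in.
by rewrite !dfwith_out.
Qed.

(** The elements of A have nontrivial entries at finitely many k only, and at each k their entries
    generate a finite group. Arbitrary finite sets appear because the Coxeter generators of W bear
    no relation to those of the factors. *)
Lemma weak_dprod_locally_finite (A : set W) :
  (forall k (B : set (G k)), finite_set B -> finite_set (generated B)) ->
  finite_set A -> finite_set (generated A).
Proof.
move=> Gfin fA.
pose B k := [set f x k | x in A]; pose H k := generated (B k).
have fH k : finite_set (H k) by apply/Gfin/finite_image.
have Hsub k : subgroup (H k) by apply: generated_subgroup.
have /finite_seqP[l lE] : finite_set (\bigcup_(x in A) [set k | f x k <> 1%g]).
  by apply: bigcup_finite => // x _; apply: f_support.
have fin := finite_restricted_prod l fH (fun k => (Hsub k).1).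
apply: sub_finite_set (finite_preimage (f := f) _ fin); last first.
  by move=> x y _ _ /f_inj.
apply: smallest_sub.
  split=> [k|x y xH yH k] /=; first by rewrite f1; split=> //; case: (Hsub k).
  rewrite fM fV; have [[[H1 HV] [xk xl]] [yk yl]] := (Hsub k, xH k, yH k).
  by split; [apply: HV|move=> kl; rewrite xl // yl // mulgV].
move=> x Ax k /=; split; first by apply: sub_gen_smallest; exists x.
move=> /negP kl; apply: contrapT => xk; apply: kl.
by have : [set` l] k by rewrite -lE; exists x.
Qed.

(** An element is coded by the finite list of pairs of an index in its support and the code of its
    entry there. *)
Lemma weak_dprod_countable :
  (forall k, countable [set: G k]) -> countable [set: W].
Proof.
move=> cG.
have [c c_inj] : exists c : forall k, G k -> nat, forall k, injective (c k).
  have c_ex k : exists c : G k -> nat, injective c.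
    have /countable_injP[c c_inj] := cG k; exists c => x y.
    by apply: c_inj; rewrite in_setT.
  by exists (fun k => projT1 (cid (c_ex k))) => k; apply: (projT2 (cid (c_ex k))).
have [l lE] := choice (fun w => (finite_seqP _).1 (f_support w)).
apply/countable_injP.
exists (fun w => choice.pickle [seq (k, c k (f w k)) | k <- l w]) => x y _ _.
move=> /(pcan_inj (@choice.pickleK _)) exy; apply: f_inj.
have lxy : l x = l y.
  by have := congr1 (map fst) exy; rewrite -!map_comp !map_id.
apply: functional_extensionality_dep => k.
have [kl|/negP kl] := boolP (k \in l x).
  apply: (c_inj k); move: exy; rewrite -lxy => /eq_in_map /(_ k kl).
  by case.
have out w : ~ k \in l w -> f w k = 1%g.
  move=> kw; apply: contrapT => fk; apply: kw.
  by have : [set` l w] k by rewrite -lE.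
by rewrite !out // -lxy.
Qed.

End WeakProduct.

(** The elements of A are words in finitely many generators, so A lies in W_J for a finite J. *)
Lemma generated_set_parabolic (W : groupType) (I : choiceType) (m : I -> I -> nat)
    (s : I -> W) (hWS : coxeter_system m s) (A : set W) :
  (forall J : set I, finite_set J -> finite_set (parabolic s J)) ->
  finite_set A -> finite_set (generated A).
Proof.
move=> lf /finite_seqP[l ->].
have := lf _ (finite_seq (flatten (map (reduced_expr s) l))).
apply: sub_finite_set; apply: smallest_sub; first exact: generated_subgroup.
move=> w wl; apply/(parabolicP hWS); exists (reduced_expr s w).
  by move=> i iw /=; apply/flattenP; exists (reduced_expr s w) => //; apply: map_f.
exact: (word_prod_reduced_expr hWS).
Qed.

(** r_i negates alpha_i, whereas r_j for j different from i keeps its coefficient 1 at i. *)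
Lemma coxeter_gen_inj (R : realType) (W : groupType) (I : choiceType)
    (m : I -> I -> nat) (s : I -> W) (hWS : coxeter_system m s) : injective s.
Proof.
move=> i j sij; apply: contrapT => /eqP ij; have cox : coxeter_matrix m by case: hWS.
have := act_gen (R := R) hWS i (simple_root R i).
rewrite sij act_gen // reflection_simple // => /(congr1 (mcoeff i)).
rewrite mcoeff_reflection_neq 1?eq_sym // mcoeffN mcoeff_simple_root eqxx.
by move=> /= h; have := @ltr01 R; lra.
Qed.

Theorem theorem2p10 (R : realType) (W : groupType) (I : choiceType)
    (m : I -> I -> nat) (s : I -> W) (hWS : coxeter_system m s)
    (hinf : infinite_set [set: W]%classic) :
  complete_lattice (weak_le R m s) <->
  exists (K : countType) (G : K -> groupType),
    (forall k : K, finite_coxeter_group (G k) \/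
                   locally_finite_irreducible_coxeter_group (G k)) /\
    isog_weak_dprod W G.
Proof.
rewrite (complete_lattice_locally_finite R hWS hinf); split.
  move=> [cI lf]; have [K IK] := choicePcountable cI; exists K.
  (* [dec] depends on a bare type, so that the equality of I with a [countType] can be rewritten in
     it. *)
  pose dec (T : Type) := exists G : T -> groupType,
    (forall k, finite_coxeter_group (G k) \/
               locally_finite_irreducible_coxeter_group (G k)) /\
    isog_weak_dprod W G.
  suff : dec I by rewrite IK.
  exists (fun k => generated_group (s @` [set` component m k])).
  by split; [exact: component_factor | exact: component_isog].
move=> [K [G [GP [f [fM fbij]]]]].
have G_fin k (B : set (G k)) : finite_set B -> finite_set (generated B).
  case: (GP k) => [[fG _] _|[I' [m' [s' [sys [_ lf] _]]]]].
    exact: sub_finite_set fG.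
  exact: (generated_set_parabolic sys lf).
have G_countable k : countable [set: G k].
  case: (GP k) => [[fG _]|[I' [m' [s' [sys [_ lf] irr]]]]].
    exact: finite_set_countable.
  exact/(countable_coxeter_group sys)/(locally_finite_irreducible_countable R sys lf).
split.
  have /countable_injP[c c_inj] := weak_dprod_countable fbij G_countable.
  apply/countable_injP; exists (c \o s) => i j _ _ /c_inj sij.
  by apply: (coxeter_gen_inj R hWS); apply: sij; rewrite in_setT.
move=> J /(finite_image s); exact: (weak_dprod_locally_finite fM fbij).
Qed.
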